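(* Let $\mathbb{K}$ be a field, let $B$ and $H$ be $\mathbb{K}$-bialgebras and let $f:B\to H$ be an injective bialgebra morphism. Then the bimonad $T={}_{B}H\otimes_B-$ on the monoidal category ${}_{B}\mathcal{M}$ of left $B$-modules is left Hopf if and only if the map $$\Gamma: H\otimes_B(B\otimes_{\mathbb{K}}H)\to H\otimes_{\mathbb{K}}H,\qquad h\otimes_B(b\otimes_{\mathbb{K}}h')\mapsto h_{(1)}f(b)\otimes_{\mathbb{K}}h_{(2)}h'$$ is a bijection, where $B\otimes_{\mathbb{K}}H$ is regarded as the tensor product of two left $B$-modules.
   Context: Sweedler notation $\Delta(h)=h_{(1)}\otimes h_{(2)}$ is used. The category ${}_{B}\mathcal{M}$ is monoidal under $\otimes_{\mathbb{K}}$ with the diagonal action via $\Delta_B$ and unit $\mathbb{K}$ (with action via $\epsilon_B$). $H$ is a $B$-bimodule via $f$; in particular $B$ acts on $B\otimes_{\mathbb{K}}H$ by $b'\cdot(b\otimes h')=b'_{(1)}b\otimes f(b'_{(2)})h'$. The functor $T(M)={}_{B}H\otimes_B M$ is the monad of the adjunction (extension of scalars) $\dashv$ (restriction of scalars) along $f$: multiplication $h\otimes_B(h'\otimes_B m)\mapsto hh'\otimes_B m$, unit $m\mapsto 1_H\otimes_B m$. It is a bimonad with $T_2(M,N)(h\otimes_B(m\otimes n))=(h_{(1)}\otimes_B m)\otimes(h_{(2)}\otimes_B n)$ and $T_0:H\otimes_B\mathbb{K}\to\mathbb{K}$ induced by $\epsilon_H$. For a bimonad $(T,\mu,\eta,T_2,T_0)$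 on a monoidal category, the left fusion operator is $H^l_{X,Y}=(\mathrm{id}_{T(X)}\otimes\mu_Y)T_2(X,T(Y)):T(X\otimes T(Y))\to T(X)\otimes T(Y)$; $T$ is left Hopf if $H^l_{X,Y}$ is invertible for all objects $X,Y$. *)

(* Defs.v *)
From HB Require Import structures.
From mathcomp Require Import all_boot all_algebra.
From mathcomp Require Import boolp.

Set Implicit Arguments.
Unset Strict Implicit.
Unset Printing Implicit Defensive.

Import GRing.Theory.
Local Open Scope ring_scope.
Local Open Scope quotient_scope.

(* The tensor product [M (x)_R N] as the quotient of formal sums of pairs
   [(m, n)] by the congruence generated by biadditivity and balancedness.  The
   right action of [R] on [M] and the left action on [N] are explicit because
   MathComp has no right modules distinct from [lmodType R^c]. *)

Section TensorRelation.
Variables (R : Type) (M N : zmodType) (ra : R -> M -> M) (la : R -> N -> N).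

Inductive tens_rel : seq (M * N) -> seq (M * N) -> Prop :=
| Tens_refl s : tens_rel s s
| Tens_sym s t : tens_rel s t -> tens_rel t s
| Tens_trans s t u : tens_rel s t -> tens_rel t u -> tens_rel s u
| Tens_cat s s' t t' :
    tens_rel s s' -> tens_rel t t' -> tens_rel (s ++ t) (s' ++ t')
| Tens_comm s t : tens_rel (s ++ t) (t ++ s)
| Tens_0l n : tens_rel [:: (0, n)] [::]
| Tens_Dl m m' n : tens_rel [:: (m + m', n)] [:: (m, n); (m', n)]
| Tens_Dr m n n' : tens_rel [:: (m, n + n')] [:: (m, n); (m, n')]
| Tens_bal r m n : tens_rel [:: (ra r m, n)] [:: (m, la r n)].

Definition tens_relb s t := `[< tens_rel s t >].

Fact tens_relb_refl : reflexive tens_relb.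
Proof. by move=> s; apply/asboolP; apply: Tens_refl. Qed.

Fact tens_relb_sym : symmetric tens_relb.
Proof. by move=> s t; apply/asboolP/asboolP; apply: Tens_sym. Qed.

Fact tens_relb_trans : transitive tens_relb.
Proof.
move=> t s u /asboolP st /asboolP tu; apply/asboolP.
exact: Tens_trans st tu.
Qed.

Canonical tens_equiv :=
  EquivRel tens_relb tens_relb_refl tens_relb_sym tens_relb_trans.

Definition tens := {eq_quot tens_equiv}.
HB.instance Definition _ := Choice.on tens.

Definition tpi (s : seq (M * N)) : tens := \pi_{eq_quot tens_equiv} s.
Definition trepr (x : tens) : seq (M * N) := repr (x : {eq_quot tens_equiv}).

Fact treprK x : tpi (trepr x) = x.
Proof. exact: (@reprK _ {eq_quot tens_equiv}). Qed.

Fact tpiP s t : tens_rel s t -> tpi s = tpi t.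
Proof. by move=> st; apply/eqquotP/asboolP. Qed.

Fact tpiK s : tens_rel (trepr (tpi s)) s.
Proof.
apply/asboolP; change (tens_equiv (trepr (tpi s)) s); apply/eqmodP.
exact: (treprK (tpi s)).
Qed.

Definition tpure (m : M) (n : N) : tens := tpi [:: (m, n)].
Definition tens_zero : tens := tpi [::].
Definition tens_add (x y : tens) : tens := tpi (trepr x ++ trepr y).
Definition tens_opp (x : tens) : tens := tpi [seq (- p.1, p.2) | p <- trepr x].

Fact tens_addE s t : tens_add (tpi s) (tpi t) = tpi (s ++ t).
Proof. by apply: tpiP; apply: Tens_cat; apply: tpiK. Qed.

Fact tens_indseq (P : tens -> Prop) : (forall s, P (tpi s)) -> forall x, P x.
Proof. by move=> Ps x; rewrite -[x]treprK. Qed.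

Fact tens_addA : associative tens_add.
Proof.
elim/tens_indseq=> s; elim/tens_indseq=> t; elim/tens_indseq=> u.
by rewrite !tens_addE catA.
Qed.

Fact tens_addC : commutative tens_add.
Proof.
elim/tens_indseq=> s; elim/tens_indseq=> t; rewrite !tens_addE.
by apply: tpiP; apply: Tens_comm.
Qed.

Fact tens_add0 : left_id tens_zero tens_add.
Proof. by elim/tens_indseq=> s; rewrite tens_addE. Qed.

Fact tens_addN : left_inverse tens_zero tens_opp tens_add.
Proof.
move=> x; rewrite /tens_opp -{2}[x]treprK tens_addE.
elim: (trepr x) => [//|[m n] s IHs]; rewrite -tens_addE in IHs.
set s' := map _ s in IHs *.
rewrite map_cons -/s' -cat1s -[(m, n) :: s]cat1s -!tens_addE -tens_addA.
rewrite [X in tens_add _ X]tens_addA [X in tens_add X (tpi s)]tens_addC.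
rewrite -[X in tens_add _ X]tens_addA IHs tens_addA.
rewrite tens_addC tens_add0 tens_addE.
apply: tpiP; apply: Tens_trans (Tens_0l n).
by rewrite -(addNr m); apply/Tens_sym/Tens_Dl.
Qed.

HB.instance Definition _ :=
  GRing.isZmodule.Build tens tens_addA tens_addC tens_add0 tens_addN.

Fact tens_ind (P : tens -> Prop) :
    P 0 -> (forall m n, P (tpure m n)) ->
    (forall x y, P x -> P y -> P (x + y)) ->
  forall x, P x.
Proof.
move=> P0 P1 PD; elim/tens_indseq; elim=> [//|[m n] s IHs].
by rewrite -cat1s -tens_addE; apply: PD => //; apply: P1.
Qed.

Fact tpureDl m m' n : tpure (m + m') n = tpure m n + tpure m' n.
Proof. by rewrite [RHS]tens_addE; apply: tpiP; apply: Tens_Dl. Qed.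

Fact tpureDr m n n' : tpure m (n + n') = tpure m n + tpure m n'.
Proof. by rewrite [RHS]tens_addE; apply: tpiP; apply: Tens_Dr. Qed.

Fact tpure_bal r m n : tpure (ra r m) n = tpure m (la r n).
Proof. by apply: tpiP; apply: Tens_bal. Qed.

Definition balanced (V : zmodType) (phi : M -> N -> V) :=
  [/\ forall n, {morph phi^~ n : m m' / m + m'},
      forall m, {morph phi m : n n' / n + n'}
    & forall r m n, phi (ra r m) n = phi m (la r n)].

(* The map out of the tensor product induced by [phi]; it is meaningful when
   [phi] is balanced, see [tliftE]. *)
Definition tlift (V : zmodType) (phi : M -> N -> V) (x : tens) : V :=
  \sum_(p <- trepr x) phi p.1 p.2.

Section Lift.
Variables (V : zmodType) (phi : M -> N -> V).
Hypothesis phiP : balanced phi.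

Fact tens_rel_sum s t :
  tens_rel s t -> \sum_(p <- s) phi p.1 p.2 = \sum_(p <- t) phi p.1 p.2.
Proof.
have [phiDl phiDr phi_bal] := phiP.
elim=> [//|s' t' _ -> //|s' t' u _ -> _ -> //|s1 s2 t1 t2 _ E1 _ E2|s' t'
       |n|m m' n|m n n'|r m n].
- by rewrite !big_cat /= E1 E2.
- by rewrite !big_cat /= addrC.
- rewrite big_seq1 big_nil /=.
  by apply: (@addrI _ (phi 0 n)); rewrite -phiDl !addr0.
- by rewrite big_seq1 big_cons big_seq1 /= phiDl.
- by rewrite big_seq1 big_cons big_seq1 /= phiDr.
- by rewrite !big_seq1 /= phi_bal.
Qed.

Fact tlift_pi s : tlift phi (tpi s) = \sum_(p <- s) phi p.1 p.2.
Proof. exact/tens_rel_sum/tpiK. Qed.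

Fact tliftE m n : tlift phi (tpure m n) = phi m n.
Proof. by rewrite tlift_pi big_seq1. Qed.

Fact tliftD : {morph tlift phi : x y / x + y}.
Proof.
elim/tens_indseq=> s; elim/tens_indseq=> t.
by rewrite [_ + _]tens_addE !tlift_pi big_cat.
Qed.

Fact tlift0 : tlift phi 0 = 0.
Proof. by apply: (@addrI _ (tlift phi 0)); rewrite -tliftD !addr0. Qed.

End Lift.

Fact tens_repr x : x = \sum_(p <- trepr x) tpure p.1 p.2.
Proof.
rewrite -[LHS]treprK.
elim: (trepr x) => [|[m n] s IHs]; first by rewrite big_nil.
by rewrite big_cons -IHs -cat1s -tens_addE.
Qed.

End TensorRelation.

Local Opaque tens tpi trepr tens_zero tens_add tens_opp.

Section Lin.
Variables (R : pzRingType) (M N : lmodType R).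

Definition lin (g : M -> N) (gP : linear g) : {linear M -> N} :=
  HB.pack g (GRing.isLinear.Build R M N *:%R g gP).

Fact linear_eq (g g' : {linear M -> N}) : g =1 g' -> g = g'.
Proof.
case: g g' => [g [[g1] [g2]]] [g' [[g1'] [g2']]] /= /funext gg'.
move: g1' g2'; rewrite -{}gg' => g1' g2'.
by rewrite (Prop_irrelevance g1 g1') (Prop_irrelevance g2 g2').
Qed.

End Lin.

(* Restriction of scalars along [g]. *)
Definition resmod (A B : pzRingType) (g : {rmorphism A -> B})
  (M : lmodType B) : Type := M.

Section ResMod.
Variables (A B : pzRingType) (g : {rmorphism A -> B}) (M : lmodType B).
HB.instance Definition _ := GRing.Zmodule.on (resmod g M).

Definition res_scale (a : A) (m : resmod g M) : resmod g M := g a *: (m : M).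

Fact res_scaleA a b m : res_scale a (res_scale b m) = res_scale (a * b) m.
Proof. by rewrite /res_scale scalerA rmorphM. Qed.
Fact res_scale1 : left_id 1 res_scale.
Proof. by move=> m; rewrite /res_scale rmorph1 scale1r. Qed.
Fact res_scaleDr : right_distributive res_scale +%R.
Proof. by move=> a m n; rewrite /res_scale scalerDr. Qed.
Fact res_scaleDl m : {morph res_scale^~ m : a b / a + b}.
Proof. by move=> a b; rewrite /res_scale rmorphD scalerDl. Qed.

HB.instance Definition _ := GRing.Zmodule_isLmodule.Build A (resmod g M)
  res_scaleA res_scale1 res_scaleDr res_scaleDl.

Fact resZ a (m : resmod g M) : a *: m = (g a *: (m : M)) :> M.
Proof. by []. Qed.

End ResMod.

(* Extension of scalars [A (x)_B M] along [g : B -> A]. *)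
Definition extmod (B A : pzRingType) (g : {rmorphism B -> A}) (M : lmodType B) :
  Type := @tens B A M (fun b a => a * g b) *:%R.

Section ExtMod.
Variables (B A : pzRingType) (g : {rmorphism B -> A}) (M : lmodType B).
HB.instance Definition _ := GRing.Zmodule.on (extmod g M).

Definition ote (a : A) (m : M) : extmod g M := tpure _ _ a m.

Fact oteDl a a' m : ote (a + a') m = ote a m + ote a' m.
Proof. exact: tpureDl. Qed.
Fact oteDr a m m' : ote a (m + m') = ote a m + ote a m'.
Proof. exact: tpureDr. Qed.
Fact ote_bal a b m : ote (a * g b) m = ote a (b *: m).
Proof. exact: tpure_bal. Qed.

Fact ext_scale_bal a : balanced (fun b a => a * g b) *:%R
  (fun a' m => ote (a * a') m).
Proof.
split=> [m a1 a2|a1 m m'|b a1 m] /=; first by rewrite mulrDr oteDl.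
- exact: oteDr.
- by rewrite mulrA ote_bal.
Qed.

Definition ext_scale (a : A) (x : extmod g M) : extmod g M :=
  tlift (fun a' m => ote (a * a') m) x.

Fact ext_scaleE a a' m : ext_scale a (ote a' m) = ote (a * a') m.
Proof. exact: (tliftE (ext_scale_bal a)). Qed.
Fact ext_scaleDr : right_distributive ext_scale +%R.
Proof. by move=> a; apply: (tliftD (ext_scale_bal a)). Qed.
Fact ext_scale0 a : ext_scale a 0 = 0.
Proof. exact: (tlift0 (ext_scale_bal a)). Qed.
Fact ext_scaleA a b x : ext_scale a (ext_scale b x) = ext_scale (a * b) x.
Proof.
elim/tens_ind: x => [|a' m|x y IHx IHy]; first by rewrite !ext_scale0.
- by rewrite !ext_scaleE mulrA.
- by rewrite !ext_scaleDr IHx IHy.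
Qed.
Fact ext_scale1 : left_id 1 ext_scale.
Proof.
elim/tens_ind=> [|a' m|x y IHx IHy]; first by rewrite !ext_scale0.
- by rewrite !ext_scaleE mul1r.
- by rewrite !ext_scaleDr IHx IHy.
Qed.
Fact ext_scaleDl x : {morph ext_scale^~ x : a b / a + b}.
Proof.
move=> a b.
elim/tens_ind: x => [|a' m|x y IHx IHy]; first by rewrite !ext_scale0 addr0.
- by rewrite !ext_scaleE mulrDl oteDl.
- by rewrite !ext_scaleDr IHx IHy addrACA.
Qed.

HB.instance Definition _ := GRing.Zmodule_isLmodule.Build A (extmod g M)
  ext_scaleA ext_scale1 ext_scaleDr ext_scaleDl.

Fact extZ a a' m : a *: ote a' m = ote (a * a') m.
Proof. exact: ext_scaleE. Qed.

Fact ext_ind (P : extmod g M -> Prop) :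
    P 0 -> (forall a m, P (ote a m)) ->
    (forall x y, P x -> P y -> P (x + y)) ->
  forall x, P x.
Proof. exact: tens_ind. Qed.

End ExtMod.

(* The tensor product [M (x)_K N] of [K]-modules. *)
Definition tensK (K : comNzRingType) (M N : lmodType K) : Type :=
  @tens K M N *:%R *:%R.

Section TensK.
Variables (K : comNzRingType) (M N : lmodType K).
HB.instance Definition _ := GRing.Zmodule.on (tensK M N).

Definition otK (m : M) (n : N) : tensK M N := tpure _ _ m n.

Definition bilin (V : zmodType) (phi : M -> N -> V) :=
  @balanced K M N *:%R *:%R V phi.

Fact otKDl m m' n : otK (m + m') n = otK m n + otK m' n.
Proof. exact: tpureDl. Qed.
Fact otKDr m n n' : otK m (n + n') = otK m n + otK m n'.
Proof. exact: tpureDr. Qed.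
Fact otK_bal k m n : otK (k *: m) n = otK m (k *: n).
Proof. exact: tpure_bal. Qed.

Fact tensK_scale_bal k : bilin (fun m n => otK (k *: m) n).
Proof.
split=> [n m m'|m n n'|k' m n]; first by rewrite scalerDr otKDl.
- exact: otKDr.
- by rewrite scalerA mulrC -scalerA otK_bal.
Qed.

Definition tensK_scale (k : K) (x : tensK M N) : tensK M N :=
  tlift (fun m n => otK (k *: m) n) x.

Fact tensK_scaleE k m n : tensK_scale k (otK m n) = otK (k *: m) n.
Proof. exact: (tliftE (tensK_scale_bal k)). Qed.
Fact tensK_scaleDr : right_distributive tensK_scale +%R.
Proof. by move=> a; apply: (tliftD (tensK_scale_bal a)). Qed.
Fact tensK_scale0 k : tensK_scale k 0 = 0.
Proof. exact: (tlift0 (tensK_scale_bal k)). Qed.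
Fact tensK_scaleA a b x :
  tensK_scale a (tensK_scale b x) = tensK_scale (a * b) x.
Proof.
elim/tens_ind: x => [|m n|x y IHx IHy]; first by rewrite !tensK_scale0.
- by rewrite !tensK_scaleE scalerA.
- by rewrite !tensK_scaleDr IHx IHy.
Qed.
Fact tensK_scale1 : left_id 1 tensK_scale.
Proof.
elim/tens_ind=> [|m n|x y IHx IHy]; first by rewrite !tensK_scale0.
- by rewrite !tensK_scaleE scale1r.
- by rewrite !tensK_scaleDr IHx IHy.
Qed.
Fact tensK_scaleDl x : {morph tensK_scale^~ x : a b / a + b}.
Proof.
move=> a b.
elim/tens_ind: x => [|m n|x y IHx IHy]; first by rewrite !tensK_scale0 addr0.
- by rewrite !tensK_scaleE scalerDl otKDl.
- by rewrite !tensK_scaleDr IHx IHy addrACA.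
Qed.

HB.instance Definition _ := GRing.Zmodule_isLmodule.Build K (tensK M N)
  tensK_scaleA tensK_scale1 tensK_scaleDr tensK_scaleDl.

Fact tensKZ k m n : k *: otK m n = otK (k *: m) n.
Proof. exact: tensK_scaleE. Qed.

Fact tensK_ind (P : tensK M N -> Prop) :
    P 0 -> (forall m n, P (otK m n)) ->
    (forall x y, P x -> P y -> P (x + y)) ->
  forall x, P x.
Proof. exact: tens_ind. Qed.

End TensK.

Section TensMaps.
Variable K : comNzRingType.

Definition tmapK (M M' N N' : lmodType K) (g : M -> M') (h : N -> N')
  (x : tensK M N) : tensK M' N' := tlift (fun m n => otK (g m) (h n)) x.

Definition tassocK (M N P : lmodType K) (x : tensK (tensK M N) P) :
    tensK M (tensK N P) :=
  tlift (fun y p => tlift (fun m n => otK m (otK n p)) y) x.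

End TensMaps.

(* The algebra structure of [A1 (x)_K A2]. *)
Section TensAlg.
Variables (K : comNzRingType) (A1 A2 : algType K).
Implicit Types x y z : tensK A1 A2.

Definition tensK_mul x y : tensK A1 A2 :=
  tlift (fun a1 a2 => tlift (fun b1 b2 => otK (a1 * b1) (a2 * b2)) y) x.
Definition tensK_one : tensK A1 A2 := otK 1 1.

Fact tensK_mul_bal1 a1 a2 :
  bilin (fun (b1 : A1) (b2 : A2) => otK (a1 * b1) (a2 * b2)).
Proof.
split=> [n m m'|m n n'|k m n]; first by rewrite mulrDr otKDl.
- by rewrite mulrDr otKDr.
- by rewrite -!scalerAr otK_bal.
Qed.

Fact tensK_mul_bal y : bilin (fun (a1 : A1) (a2 : A2) =>
  tlift (fun b1 b2 => otK (a1 * b1) (a2 * b2)) y).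
Proof.
have L := tensK_mul_bal1.
split=> [a2 a1 a1'|a1 a2 a2'|k a1 a2];
  elim/tensK_ind: y => [|b1 b2|x y IHx IHy];
  rewrite ?(tlift0 (L _ _)) ?(tliftE (L _ _)) ?(tliftD (L _ _)) ?addr0 //.
- by rewrite mulrDl otKDl.
- by rewrite IHx IHy addrACA.
- by rewrite mulrDl otKDr.
- by rewrite IHx IHy addrACA.
- by rewrite -!scalerAl otK_bal.
- by rewrite IHx IHy.
Qed.

Fact tensK_mulDl : left_distributive tensK_mul +%R.
Proof. by move=> x y z; apply: (tliftD (tensK_mul_bal z)). Qed.
Fact tensK_mul0l x : tensK_mul 0 x = 0.
Proof. exact: (tlift0 (tensK_mul_bal x)). Qed.
Fact tensK_mulE1 a1 a2 b1 b2 :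
  tensK_mul (otK a1 a2) (otK b1 b2) = otK (a1 * b1) (a2 * b2).
Proof.
by rewrite /tensK_mul (tliftE (tensK_mul_bal _)) (tliftE (tensK_mul_bal1 _ _)).
Qed.
Fact tensK_mulDr : right_distributive tensK_mul +%R.
Proof.
move=> x y z; have L := tensK_mul_bal1.
elim/tensK_ind: x => [|a1 a2|x x' IHx IHx'].
- by rewrite !tensK_mul0l addr0.
- by rewrite /tensK_mul !(tliftE (tensK_mul_bal _)) (tliftD (L _ _)).
- by rewrite !tensK_mulDl IHx IHx' addrACA.
Qed.
Fact tensK_mul0r x : tensK_mul x 0 = 0.
Proof.
by apply: (@addrI _ (tensK_mul x 0)); rewrite -tensK_mulDr !addr0.
Qed.
Fact tensK_mulA : associative tensK_mul.
Proof.
move=> x y z.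
elim/tensK_ind: x => [|a1 a2|x x' IHx IHx']; first by rewrite !tensK_mul0l.
  elim/tensK_ind: y => [|b1 b2|y y' IHy IHy'].
  - by rewrite tensK_mul0l tensK_mul0r tensK_mul0l.
  - elim/tensK_ind: z => [|c1 c2|z z' IHz IHz']; first by rewrite !tensK_mul0r.
    + by rewrite !tensK_mulE1 !mulrA.
    + by rewrite !tensK_mulDr IHz IHz'.
  - by rewrite tensK_mulDl !tensK_mulDr IHy IHy' tensK_mulDl.
by rewrite !tensK_mulDl IHx IHx'.
Qed.
Fact tensK_mul1l : left_id tensK_one tensK_mul.
Proof.
elim/tensK_ind=> [|a1 a2|x x' IHx IHx']; first by rewrite !tensK_mul0r.
- by rewrite tensK_mulE1 !mul1r.
- by rewrite tensK_mulDr IHx IHx'.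
Qed.
Fact tensK_mul1r : right_id tensK_one tensK_mul.
Proof.
elim/tensK_ind=> [|a1 a2|x x' IHx IHx']; first by rewrite !tensK_mul0l.
- by rewrite tensK_mulE1 !mulr1.
- by rewrite tensK_mulDl IHx IHx'.
Qed.

HB.instance Definition _ := GRing.Zmodule_isPzRing.Build (tensK A1 A2)
  tensK_mulA tensK_mul1l tensK_mul1r tensK_mulDl tensK_mulDr.

Fact otKM (a1 b1 : A1) (a2 b2 : A2) :
  otK a1 a2 * otK b1 b2 = otK (a1 * b1) (a2 * b2).
Proof. exact: tensK_mulE1. Qed.

End TensAlg.

(* For [Ai]-modules [Mi], [M1 (x)_K M2] is a module over [A1 (x)_K A2]. *)
Definition tensA (K : comNzRingType) (A1 A2 : algType K)
    (M1 : lmodType A1) (M2 : lmodType A2) : Type :=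
  tensK (resmod (in_alg A1) M1) (resmod (in_alg A2) M2).

Section TensA.
Variables (K : comNzRingType) (A1 A2 : algType K).
Variables (M : lmodType A1) (N : lmodType A2).
HB.instance Definition _ := GRing.Zmodule.on (tensA M N).

Definition otA (m : M) (n : N) : tensA M N :=
  @otK _ (resmod (in_alg A1) M) (resmod (in_alg A2) N) m n.

Definition bilinA (V : zmodType) (phi : M -> N -> V) :=
  @bilin _ (resmod (in_alg A1) M) (resmod (in_alg A2) N) V phi.

Fact otADl m m' n : otA (m + m') n = otA m n + otA m' n.
Proof. exact: otKDl. Qed.
Fact otADr m n n' : otA m (n + n') = otA m n + otA m n'.
Proof. exact: otKDr. Qed.
Fact otA_bal k m n : otA (k%:A *: m) n = otA m (k%:A *: n).
Proof. exact: otK_bal. Qed.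

Fact tensA_ind (P : tensA M N -> Prop) :
    P 0 -> (forall m n, P (otA m n)) ->
    (forall x y, P x -> P y -> P (x + y)) ->
  forall x, P x.
Proof. exact: tens_ind. Qed.

Definition tensA_scale (a : tensK A1 A2) (x : tensA M N) : tensA M N :=
  tlift (fun a1 a2 => tlift (fun m n => otA (a1 *: m) (a2 *: n)) x) a.

Fact in_algC (A : algType K) (X : lmodType A) (k : K) (a : A) (u : X) :
  a *: (k%:A *: u) = k%:A *: (a *: u).
Proof. by rewrite !scalerA mulr_algr mulr_algl. Qed.

Fact tensA_scale_bal1 a1 a2 : bilinA (fun m n => otA (a1 *: m) (a2 *: n)).
Proof.
split=> [n m m'|m n n'|k m n]; first by rewrite scalerDr otADl.
- by rewrite scalerDr otADr.
- by rewrite !resZ !in_algC otA_bal.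
Qed.

Fact tensA_scale_bal x : bilin (fun (a1 : A1) (a2 : A2) =>
  tlift (fun m n => otA (a1 *: m) (a2 *: n)) (x : tensA M N)).
Proof.
have L := tensA_scale_bal1.
split=> [a2 a1 a1'|a1 a2 a2'|k a1 a2];
  elim/tensA_ind: x => [|b1 b2|x y IHx IHy];
  rewrite ?(tlift0 (L _ _)) ?(tliftE (L _ _)) ?(tliftD (L _ _)) ?addr0 //.
- by rewrite scalerDl otADl.
- by rewrite IHx IHy addrACA.
- by rewrite scalerDl otADr.
- by rewrite IHx IHy addrACA.
- by rewrite -[k *: a1]mulr_algl -[k *: a2]mulr_algl -!scalerA otA_bal.
- by rewrite IHx IHy.
Qed.

Fact tensA_scaleDl x : {morph tensA_scale^~ x : a b / a + b}.
Proof. exact: (tliftD (tensA_scale_bal x)). Qed.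
Fact tensA_scale0l x : tensA_scale 0 x = 0.
Proof. exact: (tlift0 (tensA_scale_bal x)). Qed.
Fact tensA_scaleE1 a1 a2 m n :
  tensA_scale (otK a1 a2) (otA m n) = otA (a1 *: m) (a2 *: n).
Proof.
rewrite /tensA_scale (tliftE (tensA_scale_bal _)).
by rewrite (tliftE (tensA_scale_bal1 _ _)).
Qed.
Fact tensA_scaleDr : right_distributive tensA_scale +%R.
Proof.
move=> x y z; have L := tensA_scale_bal1.
elim/tensK_ind: x => [|a1 a2|x x' IHx IHx'].
- by rewrite !tensA_scale0l addr0.
- by rewrite /tensA_scale !(tliftE (tensA_scale_bal _)) (tliftD (L _ _)).
- by rewrite !tensA_scaleDl IHx IHx' addrACA.
Qed.
Fact tensA_scale0r x : tensA_scale x 0 = 0.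
Proof.
by apply: (@addrI _ (tensA_scale x 0)); rewrite -tensA_scaleDr !addr0.
Qed.
Fact tensA_scaleA x y z :
  tensA_scale x (tensA_scale y z) = tensA_scale (x * y) z.
Proof.
elim/tensK_ind: x => [|a1 a2|x x' IHx IHx'].
- by rewrite mul0r !tensA_scale0l.
- elim/tensK_ind: y => [|b1 b2|y y' IHy IHy'].
  + by rewrite mulr0 tensA_scale0l tensA_scale0r.
  + elim/tensA_ind: z => [|c1 c2|z z' IHz IHz'].
    * by rewrite !tensA_scale0r.
    * by rewrite otKM !tensA_scaleE1 !scalerA.
    * by rewrite !tensA_scaleDr IHz IHz'.
  + by rewrite mulrDr !tensA_scaleDl tensA_scaleDr IHy IHy'.
- by rewrite mulrDl !tensA_scaleDl IHx IHx'.
Qed.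
Fact tensA_scale1 : left_id 1 tensA_scale.
Proof.
elim/tensA_ind=> [|a1 a2|x x' IHx IHx']; first by rewrite !tensA_scale0r.
- by rewrite tensA_scaleE1 !scale1r.
- by rewrite tensA_scaleDr IHx IHx'.
Qed.

HB.instance Definition _ :=
  GRing.Zmodule_isLmodule.Build (tensK A1 A2) (tensA M N)
    tensA_scaleA tensA_scale1 tensA_scaleDr tensA_scaleDl.

Fact tensAZ (a1 : A1) (a2 : A2) m n :
  otK a1 a2 *: otA m n = otA (a1 *: m) (a2 *: n).
Proof. exact: tensA_scaleE1. Qed.

End TensA.

HB.mixin Record isBialgebra (K : fieldType) B of GRing.Algebra K B := {
  comul : B -> tensK B B;
  counit : B -> K;
  comul_linear : linear comul;
  comul_monoid_morphism : monoid_morphism comul;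
  counit_scalar : scalar counit;
  counit_monoid_morphism : monoid_morphism counit;
  comulA : forall b,
    tassocK (tmapK comul idfun (comul b)) = tmapK idfun comul (comul b);
  comul_counitl : forall b, tlift (fun b1 b2 => counit b1 *: b2) (comul b) = b;
  comul_counitr : forall b, tlift (fun b1 b2 => counit b2 *: b1) (comul b) = b
}.

#[short(type="bialgType")]
HB.structure Definition Bialgebra (K : fieldType) :=
  {B of isBialgebra K B & GRing.Algebra K B}.

HB.instance Definition _ (K : fieldType) (B : bialgType K) :=
  GRing.isLinear.Build K B (tensK B B) *:%R (@comul K B) comul_linear.
HB.instance Definition _ (K : fieldType) (B : bialgType K) :=
  GRing.isMonoidMorphism.Build B (tensK B B) (@comul K B) comul_monoid_morphism.
HB.instance Definition _ (K : fieldType) (B : bialgType K) :=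
  GRing.isLinear.Build K B K *%R (@counit K B) counit_scalar.
HB.instance Definition _ (K : fieldType) (B : bialgType K) :=
  GRing.isMonoidMorphism.Build B K (@counit K B) counit_monoid_morphism.

HB.mixin Record isCoalgebraMorphism (K : fieldType) (B H : bialgType K)
    (f : B -> H) := {
  comul_morph : forall b, comul (f b) = tmapK f f (comul b);
  counit_morph : forall b, counit (f b) = counit b
}.

HB.structure Definition BialgebraMorphism (K : fieldType) (B H : bialgType K) :=
  {f of isCoalgebraMorphism K B H f & @GRing.LRMorphism K B H *:%R f}.

Notation "{ 'bialgebra' B '->' H }" := (BialgebraMorphism.type B H)
  (at level 0, B at level 98, H at level 99,
   format "{ 'bialgebra'  B  ->  H }") : type_scope.

Fact additive_sum (U V : zmodType) (g : U -> V) (I : Type) (r : seq I)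
    (F : I -> U) : {morph g : x y / x + y} ->
  g (\sum_(i <- r) F i) = \sum_(i <- r) g (F i).
Proof.
move=> gD; have g0 : g 0 = 0 by apply: (@addrI _ (g 0)); rewrite -gD !addr0.
exact: (big_morph _ gD g0).
Qed.

Record category := Category {
  obj :> Type;
  hom : obj -> obj -> Type;
  idm : forall X, hom X X;
  compm : forall X Y Z, hom Y Z -> hom X Y -> hom X Z;
  compm1 : forall X Y (f : hom X Y), compm f (idm X) = f;
  comp1m : forall X Y (f : hom X Y), compm (idm Y) f = f;
  compmA : forall X Y Z W (h : hom Z W) (g : hom Y Z) (f : hom X Y),
    compm h (compm g f) = compm (compm h g) f
}.

Arguments hom {c}.
Arguments idm {c}.
Arguments compm {c X Y Z}.

Notation "g \oc f" := (compm g f) (at level 50, left associativity).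

Definition is_iso (C : category) (X Y : C) (f : hom X Y) :=
  exists g : hom Y X, g \oc f = idm X /\ f \oc g = idm Y.

Record monoidal := Monoidal {
  mcat :> category;
  tenso : mcat -> mcat -> mcat;
  tensm : forall X X' Y Y' : mcat,
    hom X X' -> hom Y Y' -> hom (tenso X Y) (tenso X' Y');
  munit : mcat;
  massoc : forall X Y Z, hom (tenso (tenso X Y) Z) (tenso X (tenso Y Z));
  mlunit : forall X, hom (tenso munit X) X;
  mrunit : forall X, hom (tenso X munit) X;
  tensm1 : forall X Y, tensm (idm X) (idm Y) = idm (tenso X Y);
  tensm_comp : forall X X' X'' Y Y' Y'' (g : hom X' X'') (f : hom X X')
      (g' : hom Y' Y'') (f' : hom Y Y'),
    tensm (g \oc f) (g' \oc f') = tensm g g' \oc tensm f f';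
  massoc_iso : forall X Y Z, is_iso (massoc X Y Z);
  mlunit_iso : forall X, is_iso (mlunit X);
  mrunit_iso : forall X, is_iso (mrunit X);
  massoc_nat : forall X X' Y Y' Z Z'
      (f : hom X X') (g : hom Y Y') (h : hom Z Z'),
    massoc X' Y' Z' \oc tensm (tensm f g) h
      = tensm f (tensm g h) \oc massoc X Y Z;
  mlunit_nat : forall X Y (f : hom X Y),
    mlunit Y \oc tensm (idm munit) f = f \oc mlunit X;
  mrunit_nat : forall X Y (f : hom X Y),
    mrunit Y \oc tensm f (idm munit) = f \oc mrunit X;
  mpentagon : forall X Y Z W,
    massoc X Y (tenso Z W) \oc massoc (tenso X Y) Z W
      = tensm (idm X) (massoc Y Z W) \oc massoc X (tenso Y Z) W
          \oc tensm (massoc X Y Z) (idm W);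
  mtriangle : forall X Y,
    tensm (idm X) (mlunit Y) \oc massoc X munit Y = tensm (mrunit X) (idm Y)
}.

Arguments tenso {m}.
Arguments tensm {m X X' Y Y'}.
Arguments munit {m}.
Arguments massoc {m}.
Arguments mlunit {m}.
Arguments mrunit {m}.

(* A bimonad (opmonoidal monad): a monad whose endofunctor is comonoidal through
   [bT2], [bT0] and whose multiplication and unit are comonoidal
   transformations. *)
Record bimonad (C : monoidal) := Bimonad {
  bT :> C -> C;
  bTm : forall X Y, hom X Y -> hom (bT X) (bT Y);
  bT_mu : forall X, hom (bT (bT X)) (bT X);
  bT_eta : forall X, hom X (bT X);
  bT2 : forall X Y, hom (bT (tenso X Y)) (tenso (bT X) (bT Y));
  bT0 : hom (bT munit) munit;
  bTm1 : forall X, bTm (idm X) = idm (bT X);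
  bTm_comp : forall X Y Z (g : hom Y Z) (f : hom X Y),
    bTm (g \oc f) = bTm g \oc bTm f;
  bT_mu_nat : forall X Y (f : hom X Y),
    bT_mu Y \oc bTm (bTm f) = bTm f \oc bT_mu X;
  bT_eta_nat : forall X Y (f : hom X Y), bT_eta Y \oc f = bTm f \oc bT_eta X;
  bT_muA : forall X, bT_mu X \oc bTm (bT_mu X) = bT_mu X \oc bT_mu (bT X);
  bT_mul1 : forall X, bT_mu X \oc bT_eta (bT X) = idm (bT X);
  bT_mur1 : forall X, bT_mu X \oc bTm (bT_eta X) = idm (bT X);
  bT2_nat : forall X X' Y Y' (f : hom X X') (g : hom Y Y'),
    bT2 X' Y' \oc bTm (tensm f g) = tensm (bTm f) (bTm g) \oc bT2 X Y;
  bT2A : forall X Y Z,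
    massoc (bT X) (bT Y) (bT Z) \oc tensm (bT2 X Y) (idm (bT Z))
        \oc bT2 (tenso X Y) Z
      = tensm (idm (bT X)) (bT2 Y Z) \oc bT2 X (tenso Y Z)
          \oc bTm (massoc X Y Z);
  bT2_unitl : forall X,
    mlunit (bT X) \oc tensm bT0 (idm (bT X)) \oc bT2 munit X = bTm (mlunit X);
  bT2_unitr : forall X,
    mrunit (bT X) \oc tensm (idm (bT X)) bT0 \oc bT2 X munit = bTm (mrunit X);
  bT_mu_T2 : forall X Y,
    bT2 X Y \oc bT_mu (tenso X Y)
      = tensm (bT_mu X) (bT_mu Y) \oc bT2 (bT X) (bT Y) \oc bTm (bT2 X Y);
  bT_mu_T0 : bT0 \oc bT_mu munit = bT0 \oc bTm bT0;
  bT_eta_T2 : forall X Y,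
    bT2 X Y \oc bT_eta (tenso X Y) = tensm (bT_eta X) (bT_eta Y);
  bT_eta_T0 : bT0 \oc bT_eta munit = idm munit
}.

Definition left_fusion (C : monoidal) (T : bimonad C) (X Y : C) :
    hom (T (tenso X (T Y))) (tenso (T X) (T Y)) :=
  tensm (idm (T X)) (bT_mu T Y) \oc bT2 T X (T Y).

Definition left_Hopf (C : monoidal) (T : bimonad C) :=
  forall X Y : C, is_iso (left_fusion T X Y).

Section LmodCat.
Variable R : pzRingType.

Fact idfun_linear (M : lmodType R) : linear (@idfun M).
Proof. by []. Qed.
Fact comp_linear (M N P : lmodType R) (g : {linear N -> P})
  (f : {linear M -> N}) : linear (fun x => g (f x)).
Proof. by move=> a x y; rewrite !linearP. Qed.

Definition lmod_id (M : lmodType R) : {linear M -> M} :=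
  lin (@idfun_linear M).
Definition lmod_comp (M N P : lmodType R) (g : {linear N -> P})
  (f : {linear M -> N}) : {linear M -> P} := lin (comp_linear g f).

Fact lmod_idE M x : lmod_id M x = x. Proof. by []. Qed.
Fact lmod_compE (M N P : lmodType R) (g : {linear N -> P})
  (f : {linear M -> N}) x : lmod_comp g f x = g (f x).
Proof. by []. Qed.

Fact lin_eq22 (M N N' P : lmodType R)
    (f : {linear N -> P}) (g : {linear M -> N})
    (f' : {linear N' -> P}) (g' : {linear M -> N'}) :
  (forall x, f (g x) = f' (g' x)) -> lmod_comp f g = lmod_comp f' g'.
Proof. by move=> E; apply: linear_eq. Qed.

Fact lin_eq21 (M N P : lmodType R)
    (f : {linear N -> P}) (g : {linear M -> N}) (h : {linear M -> P}) :
  (forall x, f (g x) = h x) -> lmod_comp f g = h.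
Proof. by move=> E; apply: linear_eq. Qed.

Fact lin_eq23 (M N P N' P' : lmodType R)
    (f : {linear N -> P}) (g : {linear M -> N})
    (f' : {linear P' -> P}) (g' : {linear N' -> P'}) (h' : {linear M -> N'}) :
  (forall x, f (g x) = f' (g' (h' x))) ->
  lmod_comp f g = lmod_comp (lmod_comp f' g') h'.
Proof. by move=> E; apply: linear_eq. Qed.

Fact lin_eq33 (M N P Q N' P' : lmodType R)
    (f : {linear P -> Q}) (g : {linear N -> P}) (h : {linear M -> N})
    (f' : {linear P' -> Q}) (g' : {linear N' -> P'}) (h' : {linear M -> N'}) :
  (forall x, f (g (h x)) = f' (g' (h' x))) ->
  lmod_comp (lmod_comp f g) h = lmod_comp (lmod_comp f' g') h'.
Proof. by move=> E; apply: linear_eq. Qed.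

Fact lin_eq31 (M N P Q : lmodType R)
    (f : {linear P -> Q}) (g : {linear N -> P}) (h : {linear M -> N})
    (k : {linear M -> Q}) :
  (forall x, f (g (h x)) = k x) -> lmod_comp (lmod_comp f g) h = k.
Proof. by move=> E; apply: linear_eq. Qed.

Definition lmod_category : category.
Proof.
refine (@Category (lmodType R) (fun M N => {linear M -> N}) lmod_id lmod_comp
  _ _ _) => *; exact: linear_eq.
Defined.

End LmodCat.

Section Sweedler.
Variables (K : fieldType) (B : bialgType K).

(* A decomposition of [comul b] as a sum of pure tensors. *)
Definition sw (b : B) : seq (B * B) := trepr (comul b).

Fact swE b : comul b = \sum_(p <- sw b) otK p.1 p.2.
Proof. exact: tens_repr. Qed.

Fact comul1 : comul (1 : B) = otK 1 1.
Proof. exact: comul_monoid_morphism.1. Qed.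

Fact comul_alg (k : K) : comul (k%:A : B) = otK k%:A 1.
Proof.
have -> : comul (k%:A : B) = k *: comul 1 by exact: linearZ_LR.
by rewrite comul1 tensKZ.
Qed.

Fact counit1 : counit (1 : B) = 1.
Proof. exact: counit_monoid_morphism.1. Qed.

Fact counit_alg (k : K) : counit (k%:A : B) = k.
Proof.
have -> : counit (k%:A : B) = k * counit (1 : B) by exact: linearZ_LR.
by rewrite counit1 mulr1.
Qed.

Fact counitM (a b : B) : counit (a * b) = counit a * counit b.
Proof. exact: counit_monoid_morphism.2. Qed.

Fact comulM (a b : B) : comul (a * b) = comul a * comul b.
Proof. exact: comul_monoid_morphism.2. Qed.

Fact comulD (a b : B) : comul (a + b) = comul a + comul b.
Proof. exact: raddfD. Qed.

Section Lift.
Variables (V : zmodType) (phi : B -> B -> V).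
Hypothesis phiP : bilin phi.

Fact tlift_sum (I : Type) (r : seq I) (F : I -> tensK B B) :
  tlift phi (\sum_(i <- r) F i) = \sum_(i <- r) tlift phi (F i).
Proof. exact: (big_morph _ (tliftD phiP) (tlift0 phiP)). Qed.

Fact sw1 : \sum_(p <- sw 1) phi p.1 p.2 = phi 1 1.
Proof.
by rewrite -[LHS]/(tlift phi (comul 1)) comul1 [LHS](tliftE phiP).
Qed.

Fact swD a b : \sum_(p <- sw (a + b)) phi p.1 p.2 =
  \sum_(p <- sw a) phi p.1 p.2 + \sum_(p <- sw b) phi p.1 p.2.
Proof.
by rewrite -[LHS]/(tlift phi (comul (a + b))) comulD (tliftD phiP).
Qed.

Fact swM a b : \sum_(p <- sw (a * b)) phi p.1 p.2 =
  \sum_(p <- sw a) \sum_(q <- sw b) phi (p.1 * q.1) (p.2 * q.2).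
Proof.
rewrite -[LHS]/(tlift phi (comul (a * b))).
have -> : comul (a * b) =
    (\sum_(p <- sw a) otK p.1 p.2) * (\sum_(p <- sw b) otK p.1 p.2).
  by rewrite -!swE comulM.
rewrite mulr_suml tlift_sum; apply: eq_bigr => p _.
rewrite mulr_sumr tlift_sum; apply: eq_bigr => q _.
by rewrite otKM (tliftE phiP).
Qed.

End Lift.

Fact sw_counitl b : \sum_(p <- sw b) counit p.1 *: p.2 = b.
Proof. exact: comul_counitl. Qed.
Fact sw_counitr b : \sum_(p <- sw b) counit p.2 *: p.1 = b.
Proof. exact: comul_counitr. Qed.

Definition trilin (V : zmodType) (phi : B -> B -> B -> V) :=
  (forall z, bilin (fun x y => phi x y z)) /\ (forall x, bilin (phi x)).

Fact swA (V : zmodType) (phi : B -> B -> B -> V) b : trilin phi ->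
  \sum_(p <- sw b) \sum_(q <- sw p.1) phi q.1 q.2 p.2
  = \sum_(p <- sw b) \sum_(q <- sw p.2) phi p.1 q.1 q.2.
Proof.
move=> [bl br].
have b1 : bilin (fun x (y : tensK B B) => tlift (phi x) y).
  split=> [y x x'|x y y'|k x y].
  - elim/tensK_ind: y => [|u v|y y' IH IH'].
    + by rewrite !(tlift0 (br _)) addr0.
    + by rewrite !(tliftE (br _)); case: (bl v) => ->.
    + by rewrite !(tliftD (br _)) IH IH' addrACA.
  - exact: (tliftD (br _)).
  - elim/tensK_ind: y => [|u v|y y' IH IH'].
    + by rewrite scaler0 !(tlift0 (br _)).
    + by rewrite tensKZ !(tliftE (br _)); case: (bl v) => _ _ ->.
    + by rewrite scalerDr !(tliftD (br _)) IH IH'.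
pose Psi (t : tensK B (tensK B B)) := tlift (fun x y => tlift (phi x) y) t.
have PsiD : {morph Psi : x y / x + y} := tliftD b1.
have Psi0 : Psi 0 = 0 := tlift0 b1.
have Psi_sum I (r : seq I) F :
    Psi (\sum_(i <- r) F i) = \sum_(i <- r) Psi (F i).
  exact: (big_morph _ PsiD Psi0).
have /(congr1 Psi) := comulA b.
have -> : tmapK idfun comul (comul b) =
    \sum_(p <- sw b) otK p.1 (comul p.2) by [].
have a1 (z : B) : bilin (fun x y : B => otK x (otK y z)).
  split=> [n m m'|m n n'|k m n]; first by rewrite otKDl.
  - by rewrite !(otKDr, otKDl).
  - by rewrite otK_bal tensKZ.
have a2 : bilin (fun (y : tensK B B) (p : B) =>
    tlift (fun m n => otK m (otK n p)) y).
  split=> [n m m'|m n n'|k m n].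
  - exact: (tliftD (a1 _)).
  - elim/tensK_ind: m => [|u v|y y' IH IH'].
    + by rewrite !(tlift0 (a1 _)) addr0.
    + by rewrite !(tliftE (a1 _)) otKDr otKDr.
    + by rewrite !(tliftD (a1 _)) IH IH' addrACA.
  - elim/tensK_ind: m => [|u v|y y' IH IH'].
    + by rewrite scaler0 !(tlift0 (a1 _)).
    + by rewrite tensKZ !(tliftE (a1 _)) otK_bal tensKZ otK_bal.
    + by rewrite scalerDr !(tliftD (a1 _)) IH IH'.
have -> : tmapK comul idfun (comul b) =
    \sum_(p <- sw b) otK (comul p.1) p.2 by [].
rewrite /tassocK (big_morph _ (tliftD a2) (tlift0 a2)) !Psi_sum.
have E (p : B * B) : Psi (tlift (fun (y : tensK B B) (z : B) =>
      tlift (fun m n : B => otK m (otK n z)) y) (otK (comul p.1) p.2)) = \sum_(q <- sw p.1) phi q.1 q.2 p.2.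
  rewrite (tliftE a2) Psi_sum; apply: eq_bigr => q _.
  by rewrite /Psi (tliftE b1) (tliftE (br _)).
have E' (p : B * B) : Psi (otK p.1 (comul p.2)) =
    \sum_(q <- sw p.2) phi p.1 q.1 q.2.
  by rewrite /Psi (tliftE b1).
by under eq_bigr do rewrite E; under [RHS]eq_bigr do rewrite E'.
Qed.

End Sweedler.

Fact sw_morph (K : fieldType) (B H : bialgType K) (f : {bialgebra B -> H})
    (V : zmodType) (phi : H -> H -> V) b : bilin phi ->
  \sum_(p <- sw (f b)) phi p.1 p.2 = \sum_(p <- sw b) phi (f p.1) (f p.2).
Proof.
move=> phiP; rewrite -[LHS]/(tlift phi (comul (f b))) comul_morph.
rewrite (tlift_sum phiP); apply: eq_bigr => p _; exact: (tliftE phiP).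
Qed.

Section LmodMonoidal.
Variables (K : fieldType) (B : bialgType K).

(* [M (x)_K N] with the diagonal action of [B]. *)
Definition tensB (M N : lmodType B) : lmodType B :=
  resmod (@comul K B) (tensA M N).

Definition otB (M N : lmodType B) (m : M) (n : N) : tensB M N := otA m n.

(* The ground field with [B] acting through the counit. *)
Definition unitB : lmodType B := resmod (@counit K B) K^o.

Fact bilinAP (M N : lmodType B) (V : zmodType) (phi : M -> N -> V) :
    (forall n, {morph phi^~ n : m m' / m + m'}) ->
    (forall m, {morph phi m : n n' / n + n'}) ->
    (forall (k : K) m n, phi (k%:A *: m) n = phi m (k%:A *: n)) ->
  bilinA phi.
Proof. by []. Qed.

Section OtB.
Variables M N : lmodType B.
Implicit Types (m : M) (n : N).

Fact otBDl m m' n : otB (m + m') n = otB m n + otB m' n.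
Proof. exact: otADl. Qed.
Fact otBDr m n n' : otB m (n + n') = otB m n + otB m n'.
Proof. exact: otADr. Qed.
Fact otB_bal k m n : otB (k%:A *: m) n = otB m (k%:A *: n).
Proof. exact: otA_bal. Qed.
Fact otB0l n : otB 0 n = 0 :> tensB M N.
Proof. by apply: (@addrI _ (otB 0 n)); rewrite -otBDl !addr0. Qed.
Fact otB0r m : otB m 0 = 0 :> tensB M N.
Proof. by apply: (@addrI _ (otB m 0)); rewrite -otBDr !addr0. Qed.
Fact otB_suml (I : Type) (r : seq I) (F : I -> M) n :
  otB (\sum_(i <- r) F i) n = \sum_(i <- r) otB (F i) n.
Proof.
exact: (@additive_sum M (tensB M N) _ _ r F (fun x y => otBDl x y n)).
Qed.
Fact otB_sumr (I : Type) (r : seq I) (F : I -> N) m :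
  otB m (\sum_(i <- r) F i) = \sum_(i <- r) otB m (F i).
Proof. exact: (@additive_sum N (tensB M N) _ _ r F (otBDr m)). Qed.

Fact otBZ b m n : b *: otB m n = \sum_(p <- sw b) otB (p.1 *: m) (p.2 *: n).
Proof.
have -> : b *: otB m n = (comul b *: otA m n : tensA M N) by [].
rewrite swE scaler_suml; apply: eq_bigr => p _; exact: tensAZ.
Qed.

Fact tensB_ind (P : tensB M N -> Prop) :
    P 0 -> (forall m n, P (otB m n)) ->
    (forall x y, P x -> P y -> P (x + y)) ->
  forall x, P x.
Proof. exact: tens_ind. Qed.

Variable V : lmodType B.

Fact tensB_linear (phi : M -> N -> V) : bilinA phi ->
    (forall b m n, \sum_(p <- sw b) phi (p.1 *: m) (p.2 *: n) = b *: phi m n) ->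
  linear (tlift phi : tensB M N -> V).
Proof.
move=> phiP phiZ b x y; rewrite (tliftD phiP); congr (_ + _).
elim/tensB_ind: x => [|m n|x x' IH IH'].
- by rewrite scaler0 (tlift0 phiP) scaler0.
- rewrite otBZ (big_morph _ (tliftD phiP) (tlift0 phiP)) (tliftE phiP) -phiZ.
  by apply: eq_bigr => p _; apply: (tliftE phiP).
- by rewrite scalerDr !(tliftD phiP) scalerDr IH IH'.
Qed.

Fact tensB_ext (g g' : {linear tensB M N -> V}) :
  (forall m n, g (otB m n) = g' (otB m n)) -> g =1 g'.
Proof.
move=> gg'; elim/tensB_ind => [|//|x y IH IH']; first by rewrite !linear0.
by rewrite !linearD IH IH'.
Qed.

End OtB.

Fact inalgE (k : K) (M : lmodType B) b (m : M) :
  (k *: b) *: m = k%:A *: (b *: m).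
Proof. by rewrite scalerA mulr_algl. Qed.

Fact bilin_otB (M N : lmodType B) (m : M) (n : N) :
  bilin (fun a b : B => otB (a *: m) (b *: n)).
Proof.
split=> [b a a'|a b b'|k a b]; first by rewrite scalerDl otBDl.
- by rewrite scalerDl otBDr.
- by rewrite (inalgE _ a) (inalgE _ b) otB_bal.
Qed.

Section TensM.
Variables (M M' N N' : lmodType B).
Variables (g : {linear M -> M'}) (h : {linear N -> N'}).

Fact tensBm_bal : bilinA (fun m n => otB (g m) (h n)).
Proof.
apply: bilinAP => [n m m'|m n n'|k m n]; first by rewrite linearD otBDl.
- by rewrite linearD otBDr.
- by rewrite !linearZ_LR otB_bal.
Qed.

Fact tensBm_linear :
  linear (tlift (fun m n => otB (g m) (h n)) : tensB M N -> tensB M' N').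
Proof.
apply: tensB_linear tensBm_bal _ => b m n; rewrite otBZ.
by apply: eq_bigr => p _; rewrite !linearZ_LR.
Qed.

Definition tensBm : {linear tensB M N -> tensB M' N'} := lin tensBm_linear.

Fact tensBmE m n : tensBm (otB m n) = otB (g m) (h n).
Proof. exact: (tliftE tensBm_bal). Qed.

End TensM.

Section Assoc.
Variables M N : lmodType B.

Fact otB_algZ (k : K) (m : M) (n : N) : k%:A *: otB m n = otB (k%:A *: m) n.
Proof.
have -> : k%:A *: otB m n = (comul (k%:A : B) *: otA m n : tensA M N) by [].
by rewrite comul_alg tensAZ scale1r.
Qed.

End Assoc.

Fact assocB_bal1 (M N P : lmodType B) p :
  bilinA (fun (m : M) (n : N) => otB m (otB n (p : P))).
Proof.
apply: bilinAP => [n m m'|m n n'|k m n]; first by rewrite otBDl.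
- by rewrite otBDl otBDr.
- by rewrite otB_bal otB_algZ.
Qed.

Fact assocB_bal (M N P : lmodType B) :
  bilinA (fun (x : tensB M N) (p : P) =>
    tlift (fun m n => otB m (otB n p)) x).
Proof.
have L := @assocB_bal1 M N P.
apply: bilinAP => [p x x'|x p p'|k x p]; first exact: (tliftD (L _)).
- elim/tensB_ind: x => [|m n|x x' IH IH'].
  + by rewrite !(tlift0 (L _)) addr0.
  + by rewrite !(tliftE (L _)) !otBDr.
  + by rewrite !(tliftD (L _)) IH IH' addrACA.
- elim/tensB_ind: x => [|m n|x x' IH IH'].
  + by rewrite scaler0 !(tlift0 (L _)).
  + rewrite otB_algZ !(tliftE (L _)) otB_bal otB_algZ.
    by rewrite otB_bal.
  + by rewrite scalerDr !(tliftD (L _)) IH IH'.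
Qed.

Fact otB_trilin (M N P : lmodType B) (m : M) (n : N) (p : P) :
  trilin (fun a b c : B => otB (a *: m) (otB (b *: n) (c *: p))).
Proof.
split=> z; split=> [v u u'|u v v'|k u v]; rewrite ?scalerDl ?otBDl ?otBDr //.
- by rewrite (inalgE _ u) (inalgE _ v) otB_bal otB_algZ.
- by rewrite (inalgE _ u) (inalgE _ v) otB_bal.
Qed.

Fact assocB_linear (M N P : lmodType B) :
  linear (tlift (fun (x : tensB M N) (p : P) =>
    tlift (fun m n => otB m (otB n p)) x) :
    tensB (tensB M N) P -> tensB M (tensB N P)).
Proof.
have L := @assocB_bal1 M N P.
apply: tensB_linear (@assocB_bal M N P) _ => b x p.
elim/tensB_ind: x => [|m n|x x' IH IH'].
- rewrite (tlift0 (L _)) scaler0 big1 // => q _.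
  by rewrite scaler0 (tlift0 (L _)).
- rewrite (tliftE (L _)) otBZ.
  under [RHS]eq_bigr do rewrite otBZ otB_sumr.
  rewrite -(swA _ (otB_trilin m n p)); apply: eq_bigr => q _.
  rewrite otBZ (big_morph _ (tliftD (L _)) (tlift0 (L _))).
  by apply: eq_bigr => r _; rewrite (tliftE (L _)).
- rewrite (tliftD (L _)) scalerDr -IH -IH' -big_split; apply: eq_bigr => q _.
  by rewrite scalerDr (tliftD (L _)).
Qed.

Definition assocB (M N P : lmodType B) :
    {linear tensB (tensB M N) P -> tensB M (tensB N P)} :=
  lin (@assocB_linear M N P).

Fact assocBE (M N P : lmodType B) m n p :
  @assocB M N P (otB (otB m n) p) = otB m (otB n p).
Proof.
by rewrite [LHS](tliftE (@assocB_bal M N P)) (tliftE (@assocB_bal1 M N P p)).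
Qed.

Fact assocBV_bal1 (M N P : lmodType B) m :
  bilinA (fun (n : N) (p : P) => otB (otB (m : M) n) p).
Proof.
apply: bilinAP => [p n n'|n p p'|k n p]; first by rewrite otBDr otBDl.
- by rewrite otBDr.
- by rewrite -otB_bal -otB_bal otB_algZ.
Qed.

Fact assocBV_bal (M N P : lmodType B) :
  bilinA (fun (m : M) (x : tensB N P) =>
    tlift (fun n p => otB (otB m n) p) x).
Proof.
have L := @assocBV_bal1 M N P.
apply: bilinAP => [x m m'|m x x'|k m x]; last first.
- elim/tensB_ind: x => [|n p|x x' IH IH'].
  + by rewrite scaler0 !(tlift0 (L _)).
  + by rewrite otB_algZ !(tliftE (L _)) otB_bal.
  + by rewrite scalerDr !(tliftD (L _)) IH IH'.
- exact: (tliftD (L _)).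
- elim/tensB_ind: x => [|n p|x x' IH IH'].
  + by rewrite !(tlift0 (L _)) addr0.
  + by rewrite !(tliftE (L _)) !otBDl.
  + by rewrite !(tliftD (L _)) IH IH' addrACA.
Qed.

Fact otB_trilinV (M N P : lmodType B) (m : M) (n : N) (p : P) :
  trilin (fun a b c : B => otB (otB (a *: m) (b *: n)) (c *: p)).
Proof.
split=> z; split=> [v u u'|u v v'|k u v];
  rewrite ?scalerDl ?otBDr ?otBDl ?otBDr //.
- by rewrite (inalgE _ u) (inalgE _ v) otB_bal.
- by rewrite (inalgE _ u) (inalgE _ v) -otB_bal -otB_bal otB_algZ.
Qed.

Fact assocBV_linear (M N P : lmodType B) :
  linear (tlift (fun (m : M) (x : tensB N P) =>
    tlift (fun n p => otB (otB m n) p) x) :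
    tensB M (tensB N P) -> tensB (tensB M N) P).
Proof.
have L := @assocBV_bal1 M N P.
apply: tensB_linear (@assocBV_bal M N P) _ => b m x.
elim/tensB_ind: x => [|n p|x x' IH IH'].
- rewrite (tlift0 (L _)) scaler0 big1 // => q _.
  by rewrite scaler0 (tlift0 (L _)).
- rewrite (tliftE (L _)) otBZ.
  under [RHS]eq_bigr do rewrite otBZ otB_suml.
  rewrite (swA _ (otB_trilinV m n p)); apply: eq_bigr => q _.
  rewrite otBZ (big_morph _ (tliftD (L _)) (tlift0 (L _))).
  by apply: eq_bigr => r _; rewrite (tliftE (L _)).
- rewrite (tliftD (L _)) scalerDr -IH -IH' -big_split; apply: eq_bigr => q _.
  by rewrite scalerDr (tliftD (L _)).
Qed.

Definition assocBV (M N P : lmodType B) :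
    {linear tensB M (tensB N P) -> tensB (tensB M N) P} :=
  lin (@assocBV_linear M N P).

Fact assocBVE (M N P : lmodType B) m n p :
  @assocBV M N P (otB m (otB n p)) = otB (otB m n) p.
Proof.
by rewrite [LHS](tliftE (@assocBV_bal M N P)) (tliftE (@assocBV_bal1 M N P m)).
Qed.

Section Units.
Variable M : lmodType B.

Fact unitBZ (b : B) (k : unitB) : b *: k = (counit b * (k : K) : K).
Proof. by []. Qed.

Fact lunitB_bal : bilinA (fun (k : unitB) (m : M) => (k : K)%:A *: m).
Proof.
apply: bilinAP => [m k k'|k m m'|a k m]; first by rewrite !scalerDl.
- exact: scalerDr.
- by rewrite unitBZ counit_alg -scalerA (inalgE a) in_algC.
Qed.

Fact lunitB_linear : linear
  (tlift (fun (k : unitB) (m : M) => (k : K)%:A *: m) : tensB unitB M -> M).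
Proof.
apply: tensB_linear lunitB_bal _ => b k m.
rewrite -[in RHS](sw_counitl b) in_algC scaler_suml scaler_sumr.
apply: eq_bigr => p _; rewrite unitBZ mulrC -scalerA.
by rewrite (inalgE _ p.2) (inalgE k _%:A).
Qed.

Definition lunitB : {linear tensB unitB M -> M} := lin lunitB_linear.

Fact lunitBE k m : lunitB (otB k m) = (k : K)%:A *: m.
Proof. exact: (tliftE lunitB_bal). Qed.

Fact runitB_bal : bilinA (fun (m : M) (k : unitB) => (k : K)%:A *: m).
Proof.
apply: bilinAP => [k m m'|m k k'|a m k]; first exact: scalerDr.
- by rewrite !scalerDl.
- by rewrite in_algC unitBZ counit_alg -scalerA [in RHS]inalgE.
Qed.

Fact runitB_linear : linear
  (tlift (fun (m : M) (k : unitB) => (k : K)%:A *: m) : tensB M unitB -> M).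
Proof.
apply: tensB_linear runitB_bal _ => b m k.
rewrite -[in RHS](sw_counitr b) in_algC scaler_suml scaler_sumr.
apply: eq_bigr => p _; rewrite unitBZ mulrC -scalerA.
by rewrite (inalgE _ p.1) (inalgE k _%:A).
Qed.

Definition runitB : {linear tensB M unitB -> M} := lin runitB_linear.

Fact runitBE m k : runitB (otB m k) = (k : K)%:A *: m.
Proof. exact: (tliftE runitB_bal). Qed.

Fact lunitBV_linear : linear (fun m : M => otB (1 : unitB) m).
Proof.
move=> b m m'; rewrite otBDr otBZ; congr (_ + _).
rewrite -[in LHS](sw_counitl b) scaler_suml otB_sumr; apply: eq_bigr => p _.
by rewrite (inalgE _ p.2) -otB_bal !unitBZ counit_alg.
Qed.

Fact runitBV_linear : linear (fun m : M => otB m (1 : unitB)).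
Proof.
move=> b m m'; rewrite otBDl otBZ; congr (_ + _).
rewrite -[in LHS](sw_counitr b) scaler_suml otB_suml; apply: eq_bigr => p _.
by rewrite (inalgE _ p.1) otB_bal !unitBZ counit_alg.
Qed.

End Units.

Local Notation "g \ol f" := (lmod_comp g f) (at level 50, left associativity).

Fact tensBm1 (M N : lmodType B) :
  tensBm (lmod_id M) (lmod_id N) = lmod_id (tensB M N).
Proof. by apply: linear_eq; apply: tensB_ext => m n; exact: tensBmE. Qed.

Fact tensBm_comp (M M' M'' N N' N'' : lmodType B)
    (g : {linear M' -> M''}) (f : {linear M -> M'})
    (g' : {linear N' -> N''}) (f' : {linear N -> N'}) :
  tensBm (g \ol f) (g' \ol f') = tensBm g g' \ol tensBm f f'.
Proof.
symmetry; apply: lin_eq21; elim/tensB_ind=> [|m n|x y IH IH'].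
- by rewrite !linear0.
- by rewrite !tensBmE.
- by rewrite !linearD IH IH'.
Qed.

Fact assocBK (M N P : lmodType B) : cancel (assocB M N P) (assocBV M N P).
Proof.
elim/tensB_ind=> [|x p|x y IH IH']; first by rewrite !linear0.
  elim/tensB_ind: x => [|m n|x y IH IH']; first by rewrite otB0l !linear0.
    by rewrite assocBE assocBVE.
  by rewrite otBDl !linearD IH IH'.
by rewrite !linearD IH IH'.
Qed.

Fact assocBVK (M N P : lmodType B) : cancel (assocBV M N P) (assocB M N P).
Proof.
elim/tensB_ind=> [|m x|x y IH IH']; first by rewrite !linear0.
  elim/tensB_ind: x => [|n p|x y IH IH']; first by rewrite otB0r !linear0.
    by rewrite assocBVE assocBE.
  by rewrite otBDr !linearD IH IH'.
by rewrite !linearD IH IH'.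
Qed.

Fact lmod_iso (M N : lmodType B) (g : {linear M -> N}) (h : {linear N -> M}) :
  cancel g h -> cancel h g -> @is_iso (lmod_category B) M N g.
Proof. by move=> gK hK; exists h; split; apply: linear_eq. Qed.

Fact assocB_iso (M N P : lmodType B) :
  @is_iso (lmod_category B) _ _ (assocB M N P).
Proof. exact: lmod_iso (@assocBK M N P) (@assocBVK M N P). Qed.

Fact lunitB_iso (M : lmodType B) : @is_iso (lmod_category B) _ _ (lunitB M).
Proof.
apply: (lmod_iso (h := lin (@lunitBV_linear M))) => [x|m]; last first.
  by rewrite lunitBE !scale1r.
elim/tensB_ind: x => [|k m|x y IH IH']; first by rewrite !linear0.
  rewrite lunitBE /= -otB_bal; congr otB.
  by rewrite unitBZ counit_alg mulr1.
by rewrite !linearD IH IH'.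
Qed.

Fact runitB_iso (M : lmodType B) : @is_iso (lmod_category B) _ _ (runitB M).
Proof.
apply: (lmod_iso (h := lin (@runitBV_linear M))) => [x|m]; last first.
  by rewrite runitBE !scale1r.
elim/tensB_ind: x => [|m k|x y IH IH']; first by rewrite !linear0.
  rewrite runitBE /= otB_bal; congr otB.
  by rewrite unitBZ counit_alg mulr1.
by rewrite !linearD IH IH'.
Qed.

Fact assocB_nat (M M' N N' P P' : lmodType B) (f : {linear M -> M'})
    (g : {linear N -> N'}) (h : {linear P -> P'}) :
  assocB M' N' P' \ol tensBm (tensBm f g) h
    = tensBm f (tensBm g h) \ol assocB M N P.
Proof.
apply: lin_eq22 => v.
elim/tensB_ind: v => [|x p|x y IH IH'].
- by rewrite !linear0.
- elim/tensB_ind: x => [|m n|x y IH IH']; first by rewrite otB0l !linear0.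
    by rewrite !(tensBmE, assocBE).
  by rewrite otBDl !linearD IH IH'.
- by rewrite !linearD IH IH'.
Qed.

Fact lunitB_nat (M N : lmodType B) (f : {linear M -> N}) :
  lunitB N \ol tensBm (lmod_id unitB) f = f \ol lunitB M.
Proof.
apply: lin_eq22; elim/tensB_ind=> [|k m|x y IH IH'].
- by rewrite !linear0.
- by rewrite tensBmE !lunitBE linearZ_LR.
- by rewrite !linearD IH IH'.
Qed.

Fact runitB_nat (M N : lmodType B) (f : {linear M -> N}) :
  runitB N \ol tensBm f (lmod_id unitB) = f \ol runitB M.
Proof.
apply: lin_eq22; elim/tensB_ind=> [|m k|x y IH IH'].
- by rewrite !linear0.
- by rewrite tensBmE !runitBE linearZ_LR.
- by rewrite !linearD IH IH'.
Qed.

Fact pentagonB (M N P Q : lmodType B) :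
  assocB M N (tensB P Q) \ol assocB (tensB M N) P Q
    = tensBm (lmod_id M) (assocB N P Q) \ol assocB M (tensB N P) Q
        \ol tensBm (assocB M N P) (lmod_id Q).
Proof.
apply: lin_eq23 => v.
elim/tensB_ind: v => [|x q|x y IH IH'].
- by rewrite !linear0.
- elim/tensB_ind: x => [|x p|x y IH IH']; first by rewrite otB0l !linear0.
    elim/tensB_ind: x => [|m n|x y IH IH'].
    + by rewrite !otB0l !linear0.
    + by rewrite !(tensBmE, assocBE).
    + by rewrite !otBDl !linearD IH IH'.
  by rewrite otBDl !linearD IH IH'.
- by rewrite !linearD IH IH'.
Qed.

Fact triangleB (M N : lmodType B) :
  tensBm (lmod_id M) (lunitB N) \ol assocB M unitB N
    = tensBm (runitB M) (lmod_id N).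
Proof.
apply: lin_eq21 => v.
elim/tensB_ind: v => [|x n|x y IH IH'].
- by rewrite !linear0.
- elim/tensB_ind: x => [|m k|x y IH IH']; first by rewrite otB0l !linear0.
    by rewrite !(tensBmE, assocBE, lunitBE, runitBE) otB_bal.
  by rewrite otBDl !linearD IH IH'.
- by rewrite !linearD IH IH'.
Qed.

(* The monoidal category of left [B]-modules. *)
Definition lmod_monoidal : monoidal :=
  @Monoidal (lmod_category B) tensB tensBm unitB assocB lunitB runitB
    tensBm1 tensBm_comp assocB_iso lunitB_iso runitB_iso
    assocB_nat lunitB_nat runitB_nat pentagonB triangleB.

End LmodMonoidal.

Section ExtBimonad.
Variables (K : fieldType) (B H : bialgType K) (f : {bialgebra B -> H}).

(* [H (x)_B M], as a left [B]-module. *)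
Definition extB (M : lmodType B) : lmodType B := resmod f (extmod f M).

Definition otT (M : lmodType B) (h : H) (m : M) : extB M := ote f h m.

Section OtT.
Variable M : lmodType B.
Implicit Types (h : H) (m : M) (b : B).

Fact otTDl h h' m : otT (h + h') m = otT h m + otT h' m.
Proof. exact: oteDl. Qed.
Fact otTDr h m m' : otT h (m + m') = otT h m + otT h m'.
Proof. exact: oteDr. Qed.
Fact otT0r h : otT h 0 = 0 :> extB M.
Proof. by apply: (@addrI _ (otT h 0)); rewrite -otTDr !addr0. Qed.
Fact otT_bal h b m : otT (h * f b) m = otT h (b *: m).
Proof. exact: ote_bal. Qed.
Fact otTZ b h m : b *: otT h m = otT (f b * h) m.
Proof. exact: extZ. Qed.
Fact otT_suml (I : Type) (r : seq I) (F : I -> H) m :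
  otT (\sum_(i <- r) F i) m = \sum_(i <- r) otT (F i) m.
Proof. exact: (@additive_sum H (extB M) _ _ r F (fun x y => otTDl x y m)). Qed.
Fact otT_sumr (I : Type) (r : seq I) (F : I -> M) h :
  otT h (\sum_(i <- r) F i) = \sum_(i <- r) otT h (F i).
Proof. exact: (@additive_sum M (extB M) _ _ r F (otTDr h)). Qed.

Fact f_alg (k : K) : f k%:A = k%:A.
Proof.
have -> : f k%:A = k *: f 1 by exact: linearZ_LR.
by rewrite rmorph1.
Qed.

Fact otT_algl (k : K) h m : otT (k *: h) m = k%:A *: otT h m.
Proof. by rewrite otTZ f_alg mulr_algl. Qed.
Fact otT_algr (k : K) h m : otT h (k%:A *: m) = k%:A *: otT h m.
Proof. by rewrite -otT_bal f_alg mulr_algr otT_algl. Qed.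

Fact extB_ind (P : extB M -> Prop) :
    P 0 -> (forall h m, P (otT h m)) ->
    (forall x y, P x -> P y -> P (x + y)) ->
  forall x, P x.
Proof. exact: tens_ind. Qed.

Definition balT (V : zmodType) (phi : H -> M -> V) :=
  balanced (fun b h => h * f b) *:%R phi.

Fact balTP (V : zmodType) (phi : H -> M -> V) :
    (forall m, {morph phi^~ m : h h' / h + h'}) ->
    (forall h, {morph phi h : m m' / m + m'}) ->
    (forall b h m, phi (h * f b) m = phi h (b *: m)) ->
  balT phi.
Proof. by []. Qed.

Fact extB_linear (V : lmodType B) (phi : H -> M -> V) : balT phi ->
    (forall b h m, phi (f b * h) m = b *: phi h m) ->
  linear (tlift phi : extB M -> V).
Proof.
move=> phiP phiZ b x y; rewrite (tliftD phiP); congr (_ + _).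
elim/extB_ind: x => [|h m|x x' IH IH'].
- by rewrite scaler0 (tlift0 phiP) scaler0.
- by rewrite otTZ !(tliftE phiP).
- by rewrite scalerDr !(tliftD phiP) scalerDr IH IH'.
Qed.

End OtT.

Section ExtM.
Variables (M N : lmodType B) (g : {linear M -> N}).

Fact extBm_bal : balT (fun h m => otT h (g m)).
Proof.
apply: balTP => [m h h'|h m m'|b h m]; first exact: otTDl.
- by rewrite linearD otTDr.
- by rewrite linearZ_LR otT_bal.
Qed.

Fact extBm_linear : linear (tlift (fun h m => otT h (g m)) : extB M -> extB N).
Proof. by apply: (extB_linear extBm_bal) => b h m; rewrite otTZ. Qed.

Definition extBm : {linear extB M -> extB N} := lin extBm_linear.

Fact extBmE h m : extBm (otT h m) = otT h (g m).
Proof. exact: (tliftE extBm_bal). Qed.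

End ExtM.

Section Mu.
Variable M : lmodType B.

Fact muB_bal1 h : balT (fun h' (m : M) => otT (h * h') m).
Proof.
apply: balTP => [m h' h''|h' m m'|b h' m]; first by rewrite mulrDr otTDl.
- exact: otTDr.
- by rewrite mulrA otT_bal.
Qed.

Fact muB_bal : balT (fun h (x : extB M) =>
  tlift (fun h' m => otT (h * h') m) x).
Proof.
have L := muB_bal1.
apply: balTP => [x h h'|h x x'|b h x]; last first.
- elim/extB_ind: x => [|h' m|x x' IH IH'].
  + by rewrite scaler0 !(tlift0 (L _)).
  + by rewrite otTZ !(tliftE (L _)) mulrA.
  + by rewrite scalerDr !(tliftD (L _)) IH IH'.
- exact: (tliftD (L _)).
- elim/extB_ind: x => [|h2 m|x x' IH IH'].
  + by rewrite !(tlift0 (L _)) addr0.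
  + by rewrite !(tliftE (L _)) mulrDl otTDl.
  + by rewrite !(tliftD (L _)) IH IH' addrACA.
Qed.

Fact muB_linear : linear
  (tlift (fun h (x : extB M) => tlift (fun h' m => otT (h * h') m) x)
    : extB (extB M) -> extB M).
Proof.
have L := muB_bal1.
apply: (extB_linear muB_bal) => b h x.
elim/extB_ind: x => [|h' m|x x' IH IH'].
- by rewrite !(tlift0 (L _)) scaler0.
- by rewrite !(tliftE (L _)) otTZ mulrA.
- by rewrite !(tliftD (L _)) IH IH' scalerDr.
Qed.

Definition muB : {linear extB (extB M) -> extB M} := lin muB_linear.

Fact muBE h h' m : muB (otT h (otT h' m)) = otT (h * h') m.
Proof. by rewrite [LHS](tliftE muB_bal) (tliftE (muB_bal1 h)). Qed.

Fact etaB_linear : linear (fun m : M => otT 1 m).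
Proof.
by move=> b m m'; rewrite otTDr otTZ mulr1 -[f b]mul1r otT_bal.
Qed.

Definition etaB : {linear M -> extB M} := lin etaB_linear.

Fact etaBE m : etaB m = otT 1 m. Proof. by []. Qed.

End Mu.

Section T2.
Variables M N : lmodType B.

Fact T2B_bilin (m : M) (n : N) :
  bilin (fun h1 h2 : H => otB (otT h1 m) (otT h2 n)).
Proof.
split=> [u v v'|u v v'|k u v]; first by rewrite otTDl otBDl.
- by rewrite otTDl otBDr.
- by rewrite !otT_algl otB_bal.
Qed.

Definition T2B_fun (h : H) (m : M) (n : N) : tensB (extB M) (extB N) :=
  tlift (fun h1 h2 => otB (otT h1 m) (otT h2 n)) (comul h).

Fact T2B_funE h m n :
  T2B_fun h m n = \sum_(p <- sw h) otB (otT p.1 m) (otT p.2 n).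
Proof. by []. Qed.

Fact T2B_bal1 h : bilinA (T2B_fun h).
Proof.
apply: bilinAP => [n m m'|m n n'|k m n]; rewrite !T2B_funE.
- by rewrite -big_split; apply: eq_bigr => p _; rewrite otTDr otBDl.
- by rewrite -big_split; apply: eq_bigr => p _; rewrite otTDr otBDr.
- by apply: eq_bigr => p _; rewrite !otT_algr otB_bal.
Qed.

Fact T2B_bal : balT (fun h (x : tensB M N) => tlift (T2B_fun h) x).
Proof.
have L := T2B_bal1.
apply: balTP => [x h h'|h x x'|b h x]; last first.
- elim/tensB_ind: x => [|m n|x x' IH IH'].
  + by rewrite scaler0 !(tlift0 (L _)).
  + rewrite (tliftE (L _)) otBZ T2B_funE (swM (T2B_bilin m n)).
    rewrite (@additive_sum (tensB M N) _ _ _ _ _ (tliftD (L h))).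
    under [RHS]eq_bigr do rewrite (tliftE (L _)) T2B_funE.
    rewrite [RHS]exchange_big; apply: eq_bigr => p _ /=.
    have bp : bilin (fun h1 h2 : H =>
        otB (otT (p.1 * h1) m) (otT (p.2 * h2) n)).
      split=> [u v v'|u v v'|k u v]; first by rewrite mulrDr otTDl otBDl.
      - by rewrite mulrDr otTDl otBDr.
      - by rewrite -!scalerAr !otT_algl otB_bal.
    rewrite (sw_morph f b bp); apply: eq_bigr => q _.
    by rewrite !otT_bal.
  + by rewrite scalerDr !(tliftD (L _)) IH IH'.
- exact: (tliftD (L _)).
- elim/tensB_ind: x => [|m n|x x' IH IH'].
  + by rewrite !(tlift0 (L _)) addr0.
  + by rewrite !(tliftE (L _)) !T2B_funE (swD (T2B_bilin m n)).
  + by rewrite !(tliftD (L _)) IH IH' addrACA.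
Qed.

Fact T2B_linear : linear
  (tlift (fun h (x : tensB M N) => tlift (T2B_fun h) x)
    : extB (tensB M N) -> tensB (extB M) (extB N)).
Proof.
have L := T2B_bal1.
apply: (extB_linear T2B_bal) => b h x.
elim/tensB_ind: x => [|m n|x x' IH IH'].
- by rewrite !(tlift0 (L _)) scaler0.
- rewrite !(tliftE (L _)) !T2B_funE (swM (T2B_bilin m n)) exchange_big.
  rewrite scaler_sumr; apply: eq_bigr => p _ /=.
  have bp : bilin (fun h1 h2 : H =>
      otB (otT (h1 * p.1) m) (otT (h2 * p.2) n)).
    split=> [u v v'|u v v'|k u v]; first by rewrite mulrDl otTDl otBDl.
    - by rewrite mulrDl otTDl otBDr.
    - by rewrite -!scalerAl !otT_algl otB_bal.
  rewrite (sw_morph f b bp) otBZ; apply: eq_bigr => q _.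
  by rewrite !otTZ.
- by rewrite !(tliftD (L _)) IH IH' scalerDr.
Qed.

Definition T2B : {linear extB (tensB M N) -> tensB (extB M) (extB N)} :=
  lin T2B_linear.

Fact T2BE h m n : T2B (otT h (otB m n)) =
  \sum_(p <- sw h) otB (otT p.1 m) (otT p.2 n).
Proof. by rewrite [LHS](tliftE T2B_bal) (tliftE (T2B_bal1 h)). Qed.

End T2.

Fact T0B_bal : balT (fun h (k : unitB B) => counit h * (k : K) : unitB B).
Proof.
apply: balTP => [k h h'|h k k'|b h k].
- by rewrite (raddfD (@counit K H)) mulrDl.
- exact: mulrDr.
- by rewrite counitM counit_morph unitBZ mulrA.
Qed.

Fact T0B_linear : linear
  (tlift (fun h (k : unitB B) => counit h * (k : K) : unitB B)
    : extB (unitB B) -> unitB B).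
Proof.
apply: (extB_linear T0B_bal) => b h k.
by rewrite counitM counit_morph unitBZ mulrA.
Qed.

Definition T0B : {linear extB (unitB B) -> unitB B} := lin T0B_linear.

Fact T0BE h k : T0B (otT h k) = (counit h * (k : K) : unitB B).
Proof. exact: (tliftE T0B_bal). Qed.

Local Opaque otB tensBm assocB lunitB runitB otT extBm muB etaB T2B T0B.

Local Notation "g \ol f" := (lmod_comp g f) (at level 50, left associativity).

Fact extBm1 (M : lmodType B) : extBm (lmod_id M) = lmod_id (extB M).
Proof.
apply: linear_eq; elim/extB_ind=> [|h m|x y IH IH'].
- by rewrite !linear0.
- exact: extBmE.
- by rewrite !linearD IH IH'.
Qed.

Fact extBm_comp (M N P : lmodType B) (g : {linear N -> P})
  (g' : {linear M -> N}) : extBm (g \ol g') = extBm g \ol extBm g'.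
Proof.
symmetry; apply: lin_eq21; elim/extB_ind=> [|h m|x y IH IH'].
- by rewrite !linear0.
- by rewrite !extBmE.
- by rewrite !linearD IH IH'.
Qed.

Fact muB_nat (M N : lmodType B) (g : {linear M -> N}) :
  muB N \ol extBm (extBm g) = extBm g \ol muB M.
Proof.
apply: lin_eq22; elim/extB_ind=> [|h x|x y IH IH']; first by rewrite !linear0.
  elim/extB_ind: x => [|h' m|x y IH IH'].
  - by rewrite otT0r !linear0.
  - by rewrite !(extBmE, muBE).
  - by rewrite otTDr !linearD IH IH'.
by rewrite !linearD IH IH'.
Qed.

Fact etaB_nat (M N : lmodType B) (g : {linear M -> N}) :
  etaB N \ol g = extBm g \ol etaB M.
Proof. by apply: lin_eq22 => m; rewrite !etaBE extBmE. Qed.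

Fact muBA (M : lmodType B) :
  muB M \ol extBm (muB M) = muB M \ol muB (extB M).
Proof.
apply: lin_eq22; elim/extB_ind=> [|h x|x y IH IH']; first by rewrite !linear0.
  elim/extB_ind: x => [|h' x|x y IH IH'].
  - by rewrite otT0r !linear0.
  - elim/extB_ind: x => [|h2 m|x y IH IH'].
    + by rewrite !otT0r !linear0.
    + by rewrite !(extBmE, muBE) mulrA.
    + by rewrite !otTDr !linearD IH IH'.
  - by rewrite otTDr !linearD IH IH'.
by rewrite !linearD IH IH'.
Qed.

Fact muB_etal (M : lmodType B) : muB M \ol etaB (extB M) = lmod_id (extB M).
Proof.
apply: lin_eq21; elim/extB_ind=> [|h m|x y IH IH']; first by rewrite !linear0.
  by rewrite etaBE muBE mul1r.
by rewrite !linearD IH IH'.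
Qed.

Fact muB_etar (M : lmodType B) : muB M \ol extBm (etaB M) = lmod_id (extB M).
Proof.
apply: lin_eq21; elim/extB_ind=> [|h m|x y IH IH']; first by rewrite !linear0.
  by rewrite extBmE etaBE muBE mulr1.
by rewrite !linearD IH IH'.
Qed.

Fact T2B_nat (M M' N N' : lmodType B) (g : {linear M -> M'})
    (g' : {linear N -> N'}) :
  T2B M' N' \ol extBm (tensBm g g') = tensBm (extBm g) (extBm g') \ol T2B M N.
Proof.
apply: lin_eq22; elim/extB_ind=> [|h x|x y IH IH']; first by rewrite !linear0.
  elim/tensB_ind: x => [|m n|x y IH IH'].
  - by rewrite otT0r !linear0.
  - rewrite extBmE tensBmE !T2BE (linear_sum (tensBm _ _)).
    apply: eq_bigr => p _.
    by rewrite tensBmE !extBmE.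
  - by rewrite otTDr !linearD IH IH'.
by rewrite !linearD IH IH'.
Qed.

Fact T2BA (M N P : lmodType B) :
  assocB (extB M) (extB N) (extB P) \ol tensBm (T2B M N) (lmod_id (extB P))
      \ol T2B (tensB M N) P
    = tensBm (lmod_id (extB M)) (T2B N P) \ol T2B M (tensB N P)
        \ol extBm (assocB M N P).
Proof.
apply: lin_eq33; elim/extB_ind=> [|h x|x y IH IH']; first by rewrite !linear0.
  elim/tensB_ind: x => [|x p|x y IH IH'].
  - by rewrite otT0r !linear0.
  - elim/tensB_ind: x => [|m n|x y IH IH'].
    + by rewrite otB0l otT0r !linear0.
    + have tr : trilin (fun h1 h2 h3 : H =>
          otB (otT h1 m) (otB (otT h2 n) (otT h3 p))).
        split=> z; split=> [v u u'|u v v'|k u v];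
          rewrite ?otTDl ?otBDl ?otBDr //.
        * by rewrite !otT_algl otB_bal otB_algZ.
        * by rewrite !otT_algl otB_bal.
      rewrite extBmE assocBE !T2BE (linear_sum (tensBm _ _)).
      rewrite (linear_sum (assocB _ _ _)) (linear_sum (tensBm _ (T2B _ _))).
      transitivity (\sum_(q <- sw h) \sum_(r <- sw q.1)
          otB (otT r.1 m) (otB (otT r.2 n) (otT q.2 p))).
        apply: eq_bigr => q _; rewrite tensBmE lmod_idE T2BE otB_suml
          (linear_sum (assocB _ _ _)).
        by apply: eq_bigr => r _; rewrite assocBE.
      rewrite (swA h tr); apply: eq_bigr => q _.
      by rewrite tensBmE lmod_idE T2BE otB_sumr.
    + by rewrite otBDl otTDr !linearD IH IH'.
  - by rewrite otTDr !linearD IH IH'.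
by rewrite !linearD IH IH'.
Qed.

Fact T2B_unitl (M : lmodType B) :
  lunitB (extB M) \ol tensBm T0B (lmod_id (extB M)) \ol T2B (unitB B) M
    = extBm (lunitB M).
Proof.
apply: lin_eq31; elim/extB_ind=> [|h x|x y IH IH']; first by rewrite !linear0.
  elim/tensB_ind: x => [|k m|x y IH IH'].
  - by rewrite otT0r !linear0.
  - rewrite extBmE lunitBE T2BE (linear_sum (tensBm _ _)).
    rewrite (linear_sum (lunitB _)) otT_algr.
    rewrite -[in RHS](sw_counitl h) otT_suml scaler_sumr.
    apply: eq_bigr => p _.
    rewrite tensBmE lunitBE T0BE lmod_idE otT_algl mulrC scalerA.
    by rewrite mulr_algl scalerA.
  - by rewrite otTDr !linearD IH IH'.
by rewrite !linearD IH IH'.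
Qed.

Fact T2B_unitr (M : lmodType B) :
  runitB (extB M) \ol tensBm (lmod_id (extB M)) T0B \ol T2B M (unitB B)
    = extBm (runitB M).
Proof.
apply: lin_eq31; elim/extB_ind=> [|h x|x y IH IH']; first by rewrite !linear0.
  elim/tensB_ind: x => [|m k|x y IH IH'].
  - by rewrite otT0r !linear0.
  - rewrite extBmE runitBE T2BE (linear_sum (tensBm _ _)).
    rewrite (linear_sum (runitB _)) otT_algr.
    rewrite -[in RHS](sw_counitr h) otT_suml scaler_sumr.
    apply: eq_bigr => p _.
    rewrite tensBmE runitBE T0BE lmod_idE otT_algl mulrC scalerA.
    by rewrite mulr_algl scalerA.
  - by rewrite otTDr !linearD IH IH'.
by rewrite !linearD IH IH'.
Qed.

Fact muB_T2 (M N : lmodType B) :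
  T2B M N \ol muB (tensB M N)
    = tensBm (muB M) (muB N) \ol T2B (extB M) (extB N) \ol extBm (T2B M N).
Proof.
apply: lin_eq23; elim/extB_ind=> [|h x|x y IH IH']; first by rewrite !linear0.
  elim/extB_ind: x => [|h' x|x y IH IH'].
  - by rewrite otT0r !linear0.
  - elim/tensB_ind: x => [|m n|x y IH IH'].
    + by rewrite !otT0r !linear0.
    + rewrite muBE extBmE !T2BE otT_sumr (linear_sum (T2B _ _)).
      rewrite (linear_sum (tensBm _ _)) (swM (T2B_bilin m n)).
      rewrite exchange_big; apply: eq_bigr => q _.
      rewrite T2BE (linear_sum (tensBm _ _)); apply: eq_bigr => p _.
      by rewrite tensBmE !muBE.
    + by rewrite !otTDr !linearD IH IH'.
  - by rewrite otTDr !linearD IH IH'.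
by rewrite !linearD IH IH'.
Qed.

Fact muB_T0 : T0B \ol muB (unitB B) = T0B \ol extBm T0B.
Proof.
apply: lin_eq22; elim/extB_ind=> [|h x|x y IH IH']; first by rewrite !linear0.
  elim/extB_ind: x => [|h' k|x y IH IH'].
  - by rewrite otT0r !linear0.
  - by rewrite muBE extBmE !T0BE counitM mulrA.
  - by rewrite otTDr !linearD IH IH'.
by rewrite !linearD IH IH'.
Qed.

Fact etaB_T2 (M N : lmodType B) :
  T2B M N \ol etaB (tensB M N) = tensBm (etaB M) (etaB N).
Proof.
apply: lin_eq21; elim/tensB_ind=> [|m n|x y IH IH'].
- by rewrite !linear0.
- by rewrite etaBE T2BE tensBmE !etaBE (sw1 (T2B_bilin m n)).
- by rewrite !linearD IH IH'.
Qed.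

Fact etaB_T0 : T0B \ol etaB (unitB B) = lmod_id (unitB B).
Proof. by apply: lin_eq21 => k; rewrite etaBE T0BE counit1 mul1r. Qed.

(* The bimonad [H (x)_B -] on the category of left [B]-modules. *)
Definition ext_bimonad : bimonad (lmod_monoidal B) :=
  @Bimonad (lmod_monoidal B) extB extBm muB etaB T2B T0B
    extBm1 extBm_comp muB_nat etaB_nat muBA muB_etal muB_etar
    T2B_nat T2BA T2B_unitl T2B_unitr muB_T2 muB_T0 etaB_T2 etaB_T0.

(* [B (x)_K H] is the tensor product of the regular [B]-module and of [H],
   restricted along [f], with the diagonal action. *)
Definition Gamma : extmod f (tensB B^o (resmod f H^o)) -> tensK H H :=
  tlift (fun h x => tlift (fun (b : B) (h' : H) =>
    tlift (fun h1 h2 => otK (h1 * f b) (h2 * h')) (comul h)) x).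

Fact Gamma_fun_bilin (b : B) (h' : H) :
  bilin (fun h1 h2 : H => otK (h1 * f b) (h2 * h')).
Proof.
split=> [u v v'|u v v'|k u v]; first by rewrite mulrDl otKDl.
- by rewrite mulrDl otKDr.
- by rewrite -!scalerAl otK_bal.
Qed.

Fact Gamma_bal1 (h : H) :
  @bilinA K B B B^o (resmod f H^o) _ (fun (b : B) (h' : H) =>
    tlift (fun h1 h2 => otK (h1 * f b) (h2 * h')) (comul h)).
Proof.
apply: (@bilinAP _ _ B^o (resmod f H^o)) => [h' b b'|b h' h2|k b h'].
- rewrite -big_split; apply: eq_bigr => p _ /=.
  by rewrite rmorphD mulrDr otKDl.
- rewrite -big_split; apply: eq_bigr => p _ /=.
  by rewrite mulrDr otKDr.
- apply: eq_bigr => p _ /=.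
  have -> : (k%:A : B) *: (b : B^o) = k *: (b : B).
    by rewrite -[LHS]/((k%:A : B) * (b : B)) mulr_algl.
  have -> : (k%:A : B) *: (h' : resmod f H^o) = k *: (h' : H).
    rewrite -[LHS]/(f k%:A * (h' : H)).
    by rewrite f_alg mulr_algl.
  have -> : f (k *: b) = k *: f b by exact: linearZ_LR.
  by rewrite -!scalerAr otK_bal.
Qed.

Fact Gamma_bal : @balT (tensB B^o (resmod f H^o)) _ (fun h x =>
  tlift (fun (b : B) (h' : H) =>
    tlift (fun h1 h2 => otK (h1 * f b) (h2 * h')) (comul h)) x).
Proof.
have L := Gamma_bal1.
apply: balTP => [x u v|u x y|c u x].
- elim/tensB_ind: x => [|d h2|x y IH IH'].
  + by rewrite !(tlift0 (L _)) addr0.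
  + by rewrite !(tliftE (L _)) [LHS](swD (Gamma_fun_bilin d h2)).
  + by rewrite !(tliftD (L _)) IH IH' addrACA.
- exact: (tliftD (L _)).
- elim/tensB_ind: x => [|d h2|x y IH IH'].
  + by rewrite scaler0 !(tlift0 (L _)).
  + rewrite (tliftE (L _)) otBZ.
    rewrite (@additive_sum (tensB B^o (resmod f H^o)) _ _ _ _ _
      (tliftD (L u))).
    rewrite [LHS](swM (Gamma_fun_bilin d h2)).
    under [RHS]eq_bigr do rewrite (tliftE (L _)).
    rewrite [RHS]exchange_big; apply: eq_bigr => p _ /=.
    have bp : bilin (fun h1 h3 : H =>
        otK (p.1 * h1 * f d) (p.2 * h3 * h2)).
      split=> [v w w'|v w w'|k v w].
      - by rewrite mulrDr mulrDl otKDl.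
      - by rewrite mulrDr mulrDl otKDr.
      - by rewrite -!scalerAr -!scalerAl otK_bal.
    rewrite (sw_morph f c bp); apply: eq_bigr => q _.
    have -> : f (q.1 *: (d : B^o)) = f q.1 * f d by exact: rmorphM.
    have -> : q.2 *: (h2 : resmod f H^o) = f q.2 * (h2 : H) by [].
    by rewrite !mulrA.
  + by rewrite scalerDr !(tliftD (L _)) IH IH'.
Qed.

Fact GammaE h b h' :
  Gamma (ote f h (@otB K B B^o (resmod f H^o) b h'))
    = \sum_(p <- sw h) otK (p.1 * f b) (p.2 * h').
Proof. by rewrite [LHS](tliftE Gamma_bal) (tliftE (Gamma_bal1 h)). Qed.

End ExtBimonad.

Arguments Gamma {K B H} f x.

(* Main.v *)
Require Import Defs.
From mathcomp Require Import all_boot all_algebra.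

(** The left fusion operator is natural in both arguments, so what it does is
    determined by the pair of regular modules.  Concretely, write
    [T M = H (x)_B M].  A pair [x : X], [y : Y] is the same as a pair of
    [B]-linear maps [B -> X], [B -> Y] sending [1] to [x] and [y]; these induce
      - [eval_src x y : T (B (x) H) -> T (X (x) T Y)],
        [h (x) (b (x) h') |-> h (x) (b x (x) (h' (x) y))], and
      - [eval_tgt x y : H (x) H -> T X (x) T Y],
        [h (x) h' |-> (h (x) x) (x) (h' (x) y)],
    and a one-line computation on pure tensors ([fusion_eval]) shows that the
    fusion operator carries the first to the second along [Gamma]:
      [fusion (eval_src x y z) = eval_tgt x y (Gamma z)].

    If the fusion operator is invertible at [X = Y = B], this square with
    [x = y = 1] gives the bijectivity of [Gamma], because [T B] is [H] and hence
    both [eval_src 1 1] and [eval_tgt 1 1] are bijective.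

    Conversely, let [Gamma] be bijective.  Every pure tensor of [T X (x) T Y] is
    [eval_tgt x y (h (x) h')], so an inverse of the fusion operator has to send
    it to [eval_src x y (Gamma^-1 (h (x) h'))].  The point is that this
    prescription is balanced over [B] in both factors.  It is, because [Gamma]
    is linear for the right actions of [B (x) B] ([Gamma_rtrans]), hence so is
    [Gamma^-1], and because acting by [c (x) d] before evaluating at [(x, y)] is
    evaluating at [(c x, d y)] ([eval_src_rtrans]). *)

Set Implicit Arguments.
Unset Strict Implicit.
Unset Printing Implicit Defensive.

Import GRing.Theory.
Local Open Scope ring_scope.

(* Conversion would otherwise unfold these down to quotients of formal sums. *)
Local Opaque otB tensBm otT extBm muB T2B otK tlift ote tens.

(** * Additive maps on tensor products, isomorphisms of modules *)

Lemma morphD0 (U V : zmodType) (F : U -> V) :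
  {morph F : x y / x + y} -> F 0 = 0.
Proof. by move=> FD; apply: (@addrI _ (F 0)); rewrite -FD !addr0. Qed.

Lemma tens_ext (R : Type) (M N : zmodType) (ra : R -> M -> M)
    (la : R -> N -> N) (V : zmodType) (F G : tens ra la -> V) :
    {morph F : x y / x + y} -> {morph G : x y / x + y} ->
    (forall m n, F (tpure ra la m n) = G (tpure ra la m n)) ->
  F =1 G.
Proof.
move=> FD GD FG; elim/tens_ind=> [|//|x y IH IH'].
  by rewrite (morphD0 FD) (morphD0 GD).
by rewrite FD GD IH IH'.
Qed.

Lemma lmod_iso_bij (R : pzRingType) (M N : lmodType R) (g : {linear M -> N}) :
  @is_iso (lmod_category R) M N g <-> bijective g.
Proof.
split=> [[h [hg gh]]|[h gK hK]].
  exists h => x.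
    exact: (congr1 (fun k : {linear M -> M} => k x) hg).
  exact: (congr1 (fun k : {linear N -> N} => k x) gh).
have hP : linear h.
  by move=> a x y; apply: (can_inj gK); rewrite linearP !hK.
by exists (lin hP); split; apply: linear_eq => x /=.
Qed.

Section Fusion.
Variables (K : fieldType) (B H : bialgType K) (f : {bialgebra B -> H}).

(** [tens_ext] is specialised to each kind of tensor product so that the
    generators show up in the form that the computation rules rewrite. *)
Lemma tensK_ext (V : zmodType) (F G : tensK H H -> V) :
    {morph F : x y / x + y} -> {morph G : x y / x + y} ->
    (forall h h', F (otK h h') = G (otK h h')) ->
  F =1 G.
Proof. exact: tens_ext. Qed.

Lemma tensB_addext (M N : lmodType B) (V : zmodType) (F G : tensB M N -> V) :
    {morph F : x y / x + y} -> {morph G : x y / x + y} ->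
    (forall m n, F (otB m n) = G (otB m n)) ->
  F =1 G.
Proof. exact: tens_ext. Qed.

Lemma extB_addext (M : lmodType B) (V : zmodType) (F G : extB f M -> V) :
    {morph F : x y / x + y} -> {morph G : x y / x + y} ->
    (forall h m, F (otT f h m) = G (otT f h m)) ->
  F =1 G.
Proof. exact: tens_ext. Qed.

Lemma extB_tensB_addext (M N : lmodType B) (V : zmodType)
    (F G : extB f (tensB M N) -> V) :
    {morph F : x y / x + y} -> {morph G : x y / x + y} ->
    (forall h m n, F (otT f h (otB m n)) = G (otT f h (otB m n))) ->
  F =1 G.
Proof.
move=> FD GD FG; apply: extB_addext => // h.
by apply: tensB_addext => [u v|u v|m n]; rewrite ?otTDr ?FD ?GD ?FG.
Qed.

Lemma extBm_tensBm_bij (M M' N N' : lmodType B)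
    (g : {linear M -> M'}) (h : {linear N -> N'}) :
  bijective g -> bijective h -> bijective (extBm f (tensBm g h)).
Proof.
move=> /lmod_iso_bij[g' [gK gK']] /lmod_iso_bij[h' [hK hK']].
apply/lmod_iso_bij; exists (extBm f (tensBm g' h')).
rewrite /= in gK gK' hK hK'.
by split; rewrite /= -extBm_comp -tensBm_comp ?gK ?gK' ?hK ?hK' tensBm1 extBm1.
Qed.

(** * The fusion operator on generators *)

Local Notation HB := (resmod f H^o).
Local Notation BH := (extB f (tensB B^o HB)).

Lemma GammaD : {morph Gamma f : x y / x + y}.
Proof. exact: (tliftD (Gamma_bal f)). Qed.

Fact scale_at_linear (X : lmodType B) (x : X) :
  linear (fun b : B^o => (b : B) *: x).
Proof.
by move=> a b c; rewrite scalerDl; congr (_ + _); rewrite scalerA.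
Qed.

Definition scale_at (X : lmodType B) (x : X) : {linear B^o -> X} :=
  lin (scale_at_linear x).

Fact otT_at_linear (Y : lmodType B) (y : Y) :
  linear (fun h : HB => otT f h y).
Proof. by move=> a h h'; rewrite otTDl otTZ. Qed.

Definition otT_at (Y : lmodType B) (y : Y) : {linear HB -> extB f Y} :=
  lin (otT_at_linear y).

Fact mulr_linear (h : H) : linear (fun h' : HB => (h' * h : H) : HB).
Proof. by move=> a u v; rewrite [LHS]mulrDl -[X in X + _]mulrA. Qed.

(** The right action of [c (x) d] on [H (x)_B (B (x) H)], where [H] is a right
    [B]-module through [f]. *)
Definition rtrans (c d : B) : {linear BH -> BH} :=
  extBm f (tensBm (scale_at (c : B^o)) (lin (mulr_linear (f d)))).

Lemma rtransE c d h (b : B^o) (h' : HB) :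
  rtrans c d (otT f h (otB b h'))
    = otT f h (otB (b * c : B^o) (h' * f d : HB)).
Proof. by rewrite extBmE tensBmE. Qed.

(** [Gamma] only multiplies on the left of [h'] and puts [f b] rightmost in the
    first factor, so it commutes with right multiplications. *)
Lemma Gamma_rtrans c d z :
  Gamma f (rtrans c d z) = Gamma f z * otK (f c) (f d).
Proof.
move: z; apply: extB_tensB_addext => [u v|u v|h b h'].
- by rewrite linearD GammaD.
- by rewrite GammaD mulrDl.
rewrite rtransE !GammaE mulr_suml; apply: eq_bigr => p _.
by rewrite otKM rmorphM !mulrA.
Qed.

Section Modules.
Variables X Y : lmodType B.

Definition eval_src (x : X) (y : Y) :
    {linear BH -> extB f (tensB X (extB f Y))} :=
  extBm f (tensBm (scale_at x) (otT_at y)).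

Definition eval_tgt (x : X) (y : Y) (w : tensK H H) :
    tensB (extB f X) (extB f Y) :=
  tlift (fun h h' => otB (otT f h x) (otT f h' y)) w.

Definition fusionB :
    {linear extB f (tensB X (extB f Y)) -> tensB (extB f X) (extB f Y)} :=
  left_fusion (ext_bimonad f) X Y.

Lemma eval_srcE x y h (b : B^o) (h' : HB) :
  eval_src x y (otT f h (otB b h'))
    = otT f h (otB ((b : B) *: x) (otT f (h' : H) y)).
Proof. by rewrite extBmE tensBmE. Qed.

Lemma eval_tgtE x y h h' :
  eval_tgt x y (otK h h') = otB (otT f h x) (otT f h' y).
Proof. exact: (tliftE (T2B_bilin f x y)). Qed.

Lemma eval_tgtD x y : {morph eval_tgt x y : u v / u + v}.
Proof. exact: (tliftD (T2B_bilin f x y)). Qed.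

Lemma fusionBE h (x : X) h' (y : Y) :
  fusionB (otT f h (otB x (otT f h' y)))
    = \sum_(p <- sw h) otB (otT f p.1 x) (otT f (p.2 * h') y).
Proof.
rewrite -[LHS]/(tensBm (lmod_id (extB f X)) (muB f Y)
  (T2B f X (extB f Y) (otT f h (otB x (otT f h' y))))).
rewrite T2BE (linear_sum (tensBm _ _)).
by apply: eq_bigr => p _; rewrite tensBmE muBE.
Qed.

(** This is naturality of the fusion operator along the maps [B -> X] and
    [B -> Y] sending [1] to [x] and [y]; [Gamma] is its component at the
    regular modules, up to the isomorphism of [H (x)_B B] with [H]. *)
Lemma fusion_eval x y z :
  fusionB (eval_src x y z) = eval_tgt x y (Gamma f z).
Proof.
move: z; apply: extB_tensB_addext => [u v|u v|h b h'].
- by rewrite !linearD.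
- by rewrite GammaD eval_tgtD.
rewrite eval_srcE fusionBE GammaE.
rewrite [RHS](additive_sum _ _ (@eval_tgtD x y)); apply: eq_bigr => p _.
by rewrite eval_tgtE otT_bal.
Qed.

Lemma eval_srcDl x x' y z :
  eval_src (x + x') y z = eval_src x y z + eval_src x' y z.
Proof.
move: z; apply: extB_tensB_addext => [u v|u v|h b h'].
- by rewrite !linearD.
- by rewrite !linearD addrACA.
by rewrite !eval_srcE scalerDr otBDl otTDr.
Qed.

Lemma eval_srcDr x y y' z :
  eval_src x (y + y') z = eval_src x y z + eval_src x y' z.
Proof.
move: z; apply: extB_tensB_addext => [u v|u v|h b h'].
- by rewrite !linearD.
- by rewrite !linearD addrACA.
by rewrite !eval_srcE otTDr otBDr otTDr.
Qed.

Lemma eval_src_rtrans c d x y z :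
  eval_src (c *: x) (d *: y) z = eval_src x y (rtrans c d z).
Proof.
move: z; apply: extB_tensB_addext => [u v|u v|h b h']; try by rewrite !linearD.
by rewrite rtransE !eval_srcE scalerA otT_bal.
Qed.

(** * The inverse of the fusion operator *)

Section Inverse.
Variable Gi : tensK H H -> BH.
Hypotheses (GammaK : cancel (Gamma f) Gi) (GiK : cancel Gi (Gamma f)).

Lemma GiD : {morph Gi : u v / u + v}.
Proof. by move=> u v; apply: (can_inj GammaK); rewrite GammaD !GiK. Qed.

Lemma Gi_rtrans c d w : Gi (w * otK (f c) (f d)) = rtrans c d (Gi w).
Proof. by apply: (can_inj GammaK); rewrite Gamma_rtrans !GiK. Qed.

Definition unfuse_pure (h : H) (x : X) (h' : H) (y : Y) :
  extB f (tensB X (extB f Y)) := eval_src x y (Gi (otK h h')).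

(** The balancedness over [B] in both factors at once; taking [c] or [d] to be
    [1] gives it in each of them. *)
Lemma unfuse_pure_bal c d h x h' y :
  unfuse_pure (h * f c) x (h' * f d) y = unfuse_pure h (c *: x) h' (d *: y).
Proof. by rewrite /unfuse_pure -otKM Gi_rtrans eval_src_rtrans. Qed.

Lemma unfuse_balr h x : balT f (unfuse_pure h x).
Proof.
apply: balTP => [y u v|h' y y'|b h' y].
- by rewrite /unfuse_pure otKDr GiD linearD.
- exact: eval_srcDr.
- by rewrite -{1}[h]mulr1 -(rmorph1 f) unfuse_pure_bal scale1r.
Qed.

Lemma unfuse_ball (v : extB f Y) :
  balT f (fun h x => tlift (unfuse_pure h x) v).
Proof.
have rD h x := tliftD (unfuse_balr h x).
have r0 h x := tlift0 (unfuse_balr h x).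
have rE h x := tliftE (unfuse_balr h x).
apply: balTP => [x u u'|h x x'|b h x]; elim/extB_ind: v => [|h' y|v v' IH IH'].
- by rewrite !r0 addr0.
- by rewrite !rE /unfuse_pure otKDl GiD linearD.
- by rewrite !rD IH IH' addrACA.
- by rewrite !r0 addr0.
- by rewrite !rE /unfuse_pure eval_srcDl.
- by rewrite !rD IH IH' addrACA.
- by rewrite !r0.
- by rewrite !rE -{1}[h']mulr1 -(rmorph1 f) unfuse_pure_bal scale1r.
- by rewrite !rD IH IH'.
Qed.

Lemma unfuse_bal : bilinA (fun (u : extB f X) (v : extB f Y) =>
  tlift (fun h x => tlift (unfuse_pure h x) v) u).
Proof.
have rD h x := tliftD (unfuse_balr h x).
have r0 h x := tlift0 (unfuse_balr h x).
have rE h x := tliftE (unfuse_balr h x).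
have lD v := tliftD (unfuse_ball v).
have l0 v := tlift0 (unfuse_ball v).
have lE v := tliftE (unfuse_ball v).
apply: bilinAP => [v|u v v'|k u v]; first exact: lD.
- elim/extB_ind: u => [|h x|u u' IH IH'].
  + by rewrite !l0 addr0.
  + by rewrite !lE rD.
  + by rewrite !lD IH IH' addrACA.
- elim/extB_ind: u => [|h x|u u' IH IH'].
  + by rewrite scaler0 !l0.
  + elim/extB_ind: v => [|h' y|v v' IH IH'].
    * by rewrite scaler0 !lE r0 -otT_algl lE r0.
    * by rewrite -!otT_algl !lE !rE /unfuse_pure otK_bal.
    * by move: IH IH'; rewrite -otT_algl scalerDr !lE !rD => -> ->.
  + by rewrite scalerDr !lD IH IH'.
Qed.

Definition unfuse : tensB (extB f X) (extB f Y) ->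
    extB f (tensB X (extB f Y)) :=
  tlift (fun u v => tlift (fun h x => tlift (unfuse_pure h x) v) u).

Lemma unfuseD : {morph unfuse : u v / u + v}.
Proof. exact: (tliftD unfuse_bal). Qed.

Lemma unfuseE h x h' y :
  unfuse (otB (otT f h x) (otT f h' y)) = eval_src x y (Gi (otK h h')).
Proof.
rewrite [LHS](tliftE unfuse_bal) [LHS](tliftE (unfuse_ball _)).
exact: (tliftE (unfuse_balr h x)).
Qed.

Lemma unfuse_eval x y w : unfuse (eval_tgt x y w) = eval_src x y (Gi w).
Proof.
move: w; apply: tensK_ext => [u v|u v|h h'].
- by rewrite eval_tgtD unfuseD.
- by rewrite GiD linearD.
- by rewrite eval_tgtE unfuseE.
Qed.

Lemma fusionK : cancel fusionB unfuse.
Proof.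
apply: extB_tensB_addext => // [u v|h x v]; first by rewrite linearD unfuseD.
move: v; apply: extB_addext => [u v|u v|h' y].
- by rewrite otBDr otTDr linearD unfuseD.
- by rewrite otBDr otTDr.
(* The generators of the source are the values of the [eval_src x y]. *)
have -> : otT f h (otB x (otT f h' y)) =
    eval_src x y (otT f h (otB (1 : B^o) (h' : HB))).
  by rewrite eval_srcE scale1r.
by rewrite fusion_eval unfuse_eval GammaK.
Qed.

Lemma unfuseK : cancel unfuse fusionB.
Proof.
apply: tensB_addext => // [u v|u]; first by rewrite unfuseD linearD.
apply: extB_addext => [v v'|v v'|h' y].
- by rewrite otBDr unfuseD linearD.
- by rewrite otBDr.
move: u; apply: extB_addext => [u v|u v|h x].
- by rewrite otBDl unfuseD linearD.
- by rewrite otBDl.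
by rewrite unfuseE fusion_eval GiK eval_tgtE.
Qed.

End Inverse.

End Modules.

(** * Evaluation at the units of the regular modules *)

Lemma regT_bal : @balT K B H f B^o H (fun h b => h * f b).
Proof.
apply: (@balTP _ _ _ f B^o) => [b h h'|h b b'|c h b]; first exact: mulrDl.
- by rewrite rmorphD mulrDr.
- by rewrite -mulrA -rmorphM.
Qed.

Fact regT_linear : linear (tlift (fun h b => h * f b) : extB f B^o -> HB).
Proof.
by apply: (@extB_linear _ _ _ f B^o HB _ regT_bal) => b h c; rewrite -mulrA.
Qed.

(** The canonical isomorphism of [H (x)_B B] with [H]. *)
Definition regT : {linear extB f B^o -> HB} := lin regT_linear.

Lemma regTE h (b : B^o) : regT (otT f h b) = h * f b.
Proof. exact: (tliftE regT_bal). Qed.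

Lemma regTK : cancel regT (otT_at (1 : B^o)).
Proof.
apply: extB_addext => // [u v|h b]; first by rewrite !linearD.
by rewrite regTE /= otT_bal [_ *: _]mulr1.
Qed.

Lemma otT_atK : cancel (otT_at (1 : B^o)) regT.
Proof. by move=> h; rewrite regTE rmorph1 mulr1. Qed.

Lemma eval_src1_bij : bijective (eval_src (1 : B^o) (1 : B^o)).
Proof.
apply: extBm_tensBm_bij; last by exists regT; [exact: otT_atK | exact: regTK].
by exists id => b; exact: mulr1.
Qed.

Definition regTT_fun (u v : extB f B^o) : tensK H H :=
  otK (regT u : H) (regT v : H).

Lemma regTT_bal : bilinA regTT_fun.
Proof.
rewrite /regTT_fun; apply: bilinAP => [v u u'|u v v'|k u v].
- by rewrite linearD otKDl.
- by rewrite linearD otKDr.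
- have regTZ w : regT (k%:A *: w) = k *: (regT w : H).
    by rewrite linearZ_LR -[LHS]/(f k%:A * (regT w : H)) f_alg mulr_algl.
  by rewrite !regTZ otK_bal.
Qed.

Definition regTT : tensB (extB f B^o) (extB f B^o) -> tensK H H :=
  tlift regTT_fun.

Lemma regTTE u v : regTT (otB u v) = otK (regT u : H) (regT v : H).
Proof. exact: (tliftE regTT_bal). Qed.

Lemma regTTD : {morph regTT : u v / u + v}.
Proof. exact: (tliftD regTT_bal). Qed.

Lemma eval_tgt1K : cancel (eval_tgt (1 : B^o) (1 : B^o)) regTT.
Proof.
apply: tensK_ext => // [u v|h h']; first by rewrite eval_tgtD regTTD.
by rewrite eval_tgtE regTTE !otT_atK.
Qed.

Lemma Gamma_bij_of_fusion :
  bijective (fusionB B^o B^o) -> bijective (Gamma f).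
Proof.
case=> fusV fusK fusVK; have [srcV srcK srcVK] := eval_src1_bij.
exists (fun w => srcV (fusV (eval_tgt (1 : B^o) (1 : B^o) w))) => [z|w].
  by rewrite -fusion_eval fusK srcK.
by apply: (can_inj eval_tgt1K); rewrite -fusion_eval srcVK fusVK.
Qed.

End Fusion.

Theorem theorem4p11 (K : fieldType) (B H : bialgType K)
    (f : {bialgebra B -> H}) (f_inj : injective f) :
  left_Hopf (ext_bimonad f) <-> bijective (Gamma f).
Proof.
split=> [hopf|[Gi GammaK GiK] X Y].
  apply: Gamma_bij_of_fusion.
  exact: ((lmod_iso_bij (fusionB f B^o B^o)).1 (hopf B^o B^o)).
apply: ((lmod_iso_bij (fusionB f X Y)).2 _).
by exists (unfuse Gi); [exact: fusionK GammaK GiK | exact: unfuseK GammaK GiK].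
Qed.
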